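(* For an almost canonical cut and project scheme there is a commutative diagram $$\begin{array}{ccccccccc} \cdots\to& H_{*+n}(\Gamma;\underline{A}_* )&\stackrel{j_*}{\longrightarrow}& H_{*+n}(\Gamma;\underline{T}_* )&\stackrel{m_*}{\longrightarrow}& H_{*}(\Gamma;C_n)&\to& H_{*+n-1}(\Gamma;\underline{A}_* ) &\to\cdots\\ &\downarrow&&\downarrow&&\downarrow\cong&&\downarrow&\\ \cdots \to& H_{*+1}(\Gamma; C_{n-1}) &\to & H_{*+1}(\Gamma;C^0_{n-2})& \to &H_*(\Gamma;C_n)&\to &H_*(\Gamma;C_{n-1})&\to\cdots \end{array}$$ in which the rows are exact. Here the top row is the long exact sequence of $0\to \underline{A}_*\stackrel{j}{\to}\underline{T}_*\stackrel{m}{\to}C_n[n]\to0$, the bottom row is the long exact sequence of $0\to C_n\to C_{n-1}\to C_{n-2}^0\to0$, and the vertical maps are induced by the obvious projections.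
   Context: Cut and project scheme: a Euclidean space $E$ of dimension $N$, a lattice $\Gamma\subset E$, a direct sum decomposition $E=E^\|\oplus E^\perp$ with projections $\pi^\|,\pi^\perp$, $\dim E^\|=d$, $\dim E^\perp=n$, $N=d+n$, such that $\pi^\|$ and $\pi^\perp$ are injective on $\Gamma$ with dense images, and a window $K\subset E^\perp$, a finite union of compact non-degenerate polyhedra whose boundary $\partial K$ is a finite union of $(n-1)$-dimensional faces $f_i$. Put $\Gamma^\perp=\pi^\perp(\Gamma)$ and $S=E^\|+\Gamma+\partial K$. The scheme is almost canonical if for each $f_i$ the set $f_i+\Gamma^\perp$ contains the affine span of $f_i$. Then there is a finite family $\{W_\alpha\}_{\alpha\in I_{n-1}}$ of $(n-1)$-dimensional affine subspaces of $E^\perp$ with $S=E^\|+\Gamma^\perp+\bigcup_\alpha W_\alpha$, chosen with the least possible number of elements. Singular $(n-1)$-spaces are the $W_\alpha+\gamma$, $\gamma\in\Gamma^\perp$; non-empty finite intersections are the singular spaces of lower dimension. $\Gamma$ acts on $E^\perp$ by translation via $\pi^\perp$. Modules: a $\mathcal C$-tope is a compact polyhedron in $E^\perp$ whose boundary lies in a finite union of singular $(n-1)$-spaces. $C_n$ is the $\mathbb{Z}\Gamma$-module generated by indicator functions of $\mathcal C$-topes, and for $r<n$, $C_r$ is generated by indicator functions of $r$-dimensional facets of $\mathcal C$-topes, functions being identified when they differ only on lower-dimensional sets; i.e. $C_r$ is the direct limit, under subdivision, of the groups of cellular $r$-chains of the cell decompositions of $E^\perp$ by locally finite subfamilies of singular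 $(n-1)$-spaces exhausting all of them. With the cellular boundary $\delta$ and augmentation there is an exact $\Gamma$-equivariant complex $0\to C_n\to C_{n-1}\to\cdots\to C_0\to\mathbb{Z}\to0$, with $C_r$ in degree $r$ and $\mathbb{Z}=:C_{-1}$ in degree $-1$. Put $C_r^0=\ker(C_r\to C_{r-1})$ (with $C_{-1}^0=\mathbb{Z}$). Complexes: $\underline{A}_*$ is $0\to C_{n-1}\to\cdots\to C_0\to0$; $\underline{T}_*$ is $0\to C_n\to\cdots\to C_0\to0$; $\underline{D}^{n-1}_*$ is $0\to C_n\to C_{n-1}\to 0$; for a module $M$, $M[r]$ is the complex with single entry $M$ in degree $r$. For a bounded complex $\underline{M}_*$ of $\mathbb{Z}\Gamma$-modules, $H_*(\Gamma;\underline{M}_* )$ is the total homology of $\underline{P}_*\otimes_{\mathbb{Z}\Gamma}\underline{M}_*$ for a projective $\mathbb{Z}\Gamma$-resolution $\underline{P}_*$ of $\mathbb{Z}$; so $H_{*+r}(\Gamma;M[r])=H_*(\Gamma;M)$. The obvious projections are $\underline{A}_*\to C_{n-1}[n-1]$, $\underline{T}_*\to\underline{D}^{n-1}_*$ and the identity of $C_n[n]$; one uses the identifications $H_{*+n}(\Gamma;C_{n-1}[n-1])=H_{*+1}(\Gamma;C_{n-1})$ and $H_{*+n}(\Gamma;\underline{D}^{n-1}_* )=H_{*+1}(\Gamma;C_{n-2}^0)$. *)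

(* Defs.v *)
From HB Require Import structures.
From mathcomp Require Import all_boot all_order all_algebra.
From mathcomp Require Import all_classical all_reals topology numfun normedtype.
From mathcomp.multinomials Require Import freeg.

Set Implicit Arguments.
Unset Strict Implicit.
Unset Printing Implicit Defensive.

Import Order.TTheory GRing.Theory Num.Theory numFieldNormedType.Exports.

Local Open Scope classical_set_scope.
Local Open Scope ring_scope.

Record subgroup (M : zmodType) := Subgroup {
  sg_set :> M -> Prop;
  sg0 : sg_set 0;
  sgB : forall x y, sg_set x -> sg_set y -> sg_set (x - y) }.

Definition sg_pred (M : zmodType) (S : subgroup M) : M -> bool :=
  fun x => `[< S x >].

Lemma sg_predP (M : zmodType) (S : subgroup M) x : (x \in sg_pred S) <-> S x.
Proof. by split=> [/asboolP|Sx] //; exact/asboolP. Qed.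

Fact sg_pred_closed (M : zmodType) (S : subgroup M) : zmod_closed (sg_pred S).
Proof.
split; first by apply/sg_predP; exact: sg0.
by move=> x y /sg_predP Sx /sg_predP Sy; apply/sg_predP; exact: sgB.
Qed.

HB.instance Definition _ (M : zmodType) (S : subgroup M) :=
  GRing.isZmodClosed.Build M (sg_pred S) (sg_pred_closed S).

Definition sg_zmod (M : zmodType) (S : subgroup M) : zmodClosed M :=
  GRing.ZmodClosed.clone M (sg_pred S) _.

Definition sub_of (M : zmodType) (S : subgroup M) : Type :=
  {x : M | x \in sg_pred S}.

HB.instance Definition _ (M : zmodType) (S : subgroup M) :=
  SubChoice.on (sub_of S).
HB.instance Definition _ (M : zmodType) (S : subgroup M) :=
  [SubChoice_isSubZmodule of sub_of S by <:].

Definition quot_by (M : zmodType) (S : subgroup M) : zmodType :=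
  Quotient.quot (sg_zmod S).

Definition qcls (M : zmodType) (S : subgroup M) (x : M) : quot_by S :=
  (\pi_(Quotient.quot (sg_zmod S)) x)%qT.

Definition qrepr (M : zmodType) (S : subgroup M) (c : quot_by S) : M :=
  repr (c : Quotient.quot (sg_zmod S)).

Lemma qreprK (M : zmodType) (S : subgroup M) (c : quot_by S) :
  qcls S (qrepr c) = c.
Proof. exact: reprK. Qed.

Lemma qclsB (M : zmodType) (S : subgroup M) x y :
  qcls S (x - y) = qcls S x - qcls S y.
Proof. by rewrite /qcls !piE. Qed.

Lemma qclsE (M : zmodType) (S : subgroup M) x y :
  qcls S x = qcls S y <-> S (x - y).
Proof.
rewrite -sg_predP Quotient.idealrBE; split=> [h|/eqP//].
by apply/eqP.
Qed.

HB.instance Definition _ (M : zmodType) (S : subgroup M) :=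
  GRing.isZmodMorphism.Build M (quot_by S) (qcls S) (@qclsB M S).

(* Totalised at [0]: [subq_cls Z B z] is only meaningful for [Z z]. *)
Section Subquotient.
Variables (M : zmodType) (Z B : subgroup M).

Fact inner_sg0 : B (val (0 : sub_of Z)). Proof. exact: sg0. Qed.
Fact inner_sgB (x y : sub_of Z) :
  B (val x) -> B (val y) -> B (val (x - y)).
Proof. exact: sgB. Qed.
Definition inner_sg : subgroup (sub_of Z) :=
  @Subgroup (sub_of Z) (fun x => B (val x)) inner_sg0 inner_sgB.

Definition subq : zmodType := quot_by inner_sg.

Definition subq_cls (z : M) : subq := qcls inner_sg (insubd 0 z).

Definition subq_repr (c : subq) : M := val (qrepr c).

Lemma subq_reprP c : Z (subq_repr c).
Proof. by apply/sg_predP; exact: valP. Qed.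

Lemma subq_reprK c : subq_cls (subq_repr c) = c.
Proof. by rewrite /subq_cls /subq_repr valKd qreprK. Qed.

Lemma subq_clsE x y : Z x -> Z y ->
  subq_cls x = subq_cls y <-> B (x - y).
Proof.
move=> /sg_predP Zx /sg_predP Zy; rewrite /subq_cls qclsE /=.
by rewrite !insubdK.
Qed.

Lemma subq_clsB x y : Z x -> Z y ->
  subq_cls (x - y) = subq_cls x - subq_cls y.
Proof.
move=> Zx Zy; rewrite /subq_cls -qclsB; congr qcls.
apply: val_inj; rewrite /= !insubdK //; apply/sg_predP => //.
exact: sgB.
Qed.
End Subquotient.

Section SubquotientMap.
Variables (M M' : zmodType) (Z B : subgroup M) (Z' B' : subgroup M').
Variables (f : {additive M -> M'}).
Hypotheses (fZ : forall x, Z x -> Z' (f x)) (fB : forall x, B x -> B' (f x)).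

Definition subq_map (_ : forall x, Z x -> Z' (f x))
  (_ : forall x, B x -> B' (f x)) (c : subq Z B) : subq Z' B' :=
  subq_cls Z' B' (f (subq_repr c)).

Lemma subq_map_cls z : Z z ->
  subq_map fZ fB (subq_cls Z B z) = subq_cls Z' B' (f z).
Proof.
move=> Zz; apply/subq_clsE; [exact/fZ/subq_reprP|exact: fZ|].
rewrite -raddfB; apply: fB; apply/(subq_clsE B (subq_reprP _) Zz).
exact: subq_reprK.
Qed.

Lemma subq_map_is_zmod_morphism : GRing.zmod_morphism (subq_map fZ fB).
Proof.
move=> c c'; rewrite -(subq_reprK c) -(subq_reprK c').
have Zc := @subq_reprP _ Z B c; have Zc' := @subq_reprP _ Z B c'.
rewrite -subq_clsB // !subq_map_cls //; last exact: sgB.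
by rewrite raddfB subq_clsB //; exact: fZ.
Qed.

HB.instance Definition _ :=
  GRing.isZmodMorphism.Build (subq Z B) (subq Z' B') (subq_map fZ fB)
    subq_map_is_zmod_morphism.
End SubquotientMap.

(* Modules over the group ring [ZG] of an additively written abelian group [G] *)

Record gmodule (G : zmodType) := GModule {
  gcar :> zmodType;
  gact : G -> gcar -> gcar;
  gact0 : forall x, gact 0 x = x;
  gactD : forall g h x, gact (g + h) x = gact g (gact h x);
  gactB : forall g x y, gact g (x - y) = gact g x - gact g y }.

Record ghom (G : zmodType) (M N : gmodule G) := GHom {
  ghom_fun :> M -> N;
  ghomB : GRing.zmod_morphism ghom_fun;
  ghomG : forall g x, ghom_fun (gact g x) = gact g (ghom_fun x) }.

HB.instance Definition _ (G : zmodType) (M N : gmodule G) (f : ghom M N) :=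
  GRing.isZmodMorphism.Build M N (ghom_fun f) (@ghomB G M N f).

Lemma ghomD (G : zmodType) (M N : gmodule G) (f : ghom M N) x y :
  f (x + y) = f x + f y.
Proof. exact: raddfD. Qed.

Definition exact_at (A B C : zmodType) (f : A -> B) (g : B -> C) :=
  forall y, g y = 0 <-> exists x, f x = y.

Definition surj (A B : Type) (f : A -> B) := forall y, exists x, f x = y.

Definition short_exact (A B C : zmodType) (f : A -> B) (g : B -> C) :=
  [/\ injective f, exact_at f g & surj g].

Section GModuleConstructions.
Variable G : zmodType.
Implicit Types M N L : gmodule G.

Definition gtriv : gmodule G :=
  @GModule G int (fun _ x => x) (fun _ => erefl) (fun _ _ _ => erefl)
    (fun _ _ _ => erefl).

Definition gzero : gmodule G :=
  @GModule G 'rV[int]_0 (fun _ x => x) (fun _ => erefl) (fun _ _ _ => erefl)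
    (fun _ _ _ => erefl).

Fact gid_subproof M : GRing.zmod_morphism (@id M). Proof. by []. Qed.
Definition gid M : ghom M M :=
  @GHom G M M id (@gid_subproof M) (fun _ _ => erefl).

Fact gnull_subproof M N : GRing.zmod_morphism (fun _ : M => 0 : N).
Proof. by move=> x y; rewrite subr0. Qed.
Fact gact_0 M (g : G) : gact g (0 : M) = 0.
Proof. by have := gactB g (0 : M) 0; rewrite !subrr. Qed.
Definition gnull M N : ghom M N :=
  @GHom G M N (fun _ => 0) (@gnull_subproof M N)
    (fun g _ => esym (gact_0 N g)).

Fact gcomp_subproof M N L (f : ghom N L) (h : ghom M N) :
  GRing.zmod_morphism (f \o h).
Proof. exact: raddfB. Qed.
Fact gcomp_act M N L (f : ghom N L) (h : ghom M N) g x :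
  (f \o h) (gact g x) = gact g ((f \o h) x).
Proof. by rewrite /= !ghomG. Qed.
Definition gcomp M N L (f : ghom N L) (h : ghom M N) : ghom M L :=
  GHom (gcomp_subproof f h) (@gcomp_act M N L f h).

Record submodule M := Submodule {
  sm_sg :> subgroup M;
  smG : forall g x, sm_sg x -> sm_sg (gact g x) }.

Section Sub.
Variables (M : gmodule G) (S : submodule M).
Fact gsub_in g (x : sub_of S) : gact g (val x) \in sg_pred S.
Proof. by apply/sg_predP/smG/sg_predP; exact: valP. Qed.
Definition gsub_act g (x : sub_of S) : sub_of S :=
  exist _ (gact g (val x)) (gsub_in g x).
Fact gsub_act0 x : gsub_act 0 x = x.
Proof. by apply: val_inj; rewrite /= gact0. Qed.
Fact gsub_actD g h x : gsub_act (g + h) x = gsub_act g (gsub_act h x).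
Proof. by apply: val_inj; rewrite /= gactD. Qed.
Fact gsub_actB g x y : gsub_act g (x - y) = gsub_act g x - gsub_act g y.
Proof. by apply: val_inj; rewrite /= -gactB. Qed.
Definition gsub : gmodule G := GModule gsub_act0 gsub_actD gsub_actB.

Definition gquot_act g (c : quot_by S) : quot_by S := qcls S (gact g (qrepr c)).
Lemma gquot_act_cls g x : gquot_act g (qcls S x) = qcls S (gact g x).
Proof. by apply/qclsE; rewrite -gactB; apply/smG/qclsE/qreprK. Qed.
Fact gquot_act0 c : gquot_act 0 c = c.
Proof. by rewrite -(qreprK c) gquot_act_cls gact0. Qed.
Fact gquot_actD g h c : gquot_act (g + h) c = gquot_act g (gquot_act h c).
Proof. by rewrite -(qreprK c) !gquot_act_cls gactD. Qed.
Fact gquot_actB g c c' : gquot_act g (c - c') = gquot_act g c - gquot_act g c'.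
Proof.
by rewrite -(qreprK c) -(qreprK c') -qclsB !gquot_act_cls gactB qclsB.
Qed.
Definition gquot : gmodule G := GModule gquot_act0 gquot_actD gquot_actB.
End Sub.

Section Span.
Variables (M : gmodule G) (A : set M).
Definition gspan_set (x : M) : Prop :=
  forall S : submodule M, (forall a, A a -> S a) -> S x.
Fact gspan0 : gspan_set 0. Proof. by move=> S _; exact: sg0. Qed.
Fact gspanB x y : gspan_set x -> gspan_set y -> gspan_set (x - y).
Proof. by move=> Ax Ay S AS; apply: sgB; [exact: Ax|exact: Ay]. Qed.
Fact gspanG g x : gspan_set x -> gspan_set (gact g x).
Proof. by move=> Ax S AS; apply: smG; exact: Ax. Qed.
Definition gspan : submodule M :=
  @Submodule M (Subgroup gspan0 gspanB) gspanG.
End Span.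

Section Kernel.
Variables (M N : gmodule G) (f : ghom M N).
Fact gker0 : f 0 = 0. Proof. exact: raddf0. Qed.
Fact gkerB x y : f x = 0 -> f y = 0 -> f (x - y) = 0.
Proof. by move=> fx fy; rewrite ghomB fx fy subrr. Qed.
Fact gkerG g x : f x = 0 -> f (gact g x) = 0.
Proof. by move=> fx; rewrite ghomG fx gact_0. Qed.
Definition gker : submodule M :=
  @Submodule M (@Subgroup M (fun x => f x = 0) gker0 gkerB) gkerG.
End Kernel.

Section Corestriction.
Variables (M N : gmodule G) (S : submodule N) (f : ghom M N).
Hypothesis fS : forall x, S (f x).
Fact gcorestr_in x : f x \in sg_pred S. Proof. exact/sg_predP. Qed.
Definition gcorestr_fun (x : M) : gsub S :=
  exist _ (f x) (gcorestr_in x).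
Fact gcorestrB : GRing.zmod_morphism gcorestr_fun.
Proof. by move=> x y; apply: val_inj; rewrite /= raddfB. Qed.
Fact gcorestrG g x : gcorestr_fun (gact g x) = gact g (gcorestr_fun x).
Proof. by apply: val_inj; rewrite /= ghomG. Qed.
Definition gcorestr : ghom M (gsub S) := GHom gcorestrB gcorestrG.
End Corestriction.

Definition gif (b : bool) M : gmodule G := if b then M else gzero.
Definition gif_in (b : bool) M : ghom M (gif b M) :=
  if b return ghom M (gif b M) then gid M else gnull M gzero.
Definition gif_out (b : bool) M : ghom (gif b M) M :=
  if b return ghom (gif b M) M then gid M else gnull gzero M.

Lemma gif_inK (b : bool) M x : gif_out b M (gif_in b M x) = if b then x else 0.
Proof. by case: b. Qed.
Lemma gif_outK (b : bool) M x : gif_in b M (gif_out b M x) = x.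
Proof. by case: b x => //= x; apply/rowP; case. Qed.

Lemma gif_in0 (b : bool) M x : b = false -> gif_in b M x = 0.
Proof. by move=> ->. Qed.
Lemma gif_out0 (b : bool) M x : b = false -> gif_out b M x = 0.
Proof. by case: b x. Qed.

Definition gprojective (Q : gmodule G) :=
  forall (M N : gmodule G) (p : ghom M N), surj p ->
  forall f : ghom Q N, exists h : ghom Q M, forall x, p (h x) = f x.

Record proj_resolution := ProjResolution {
  pr_mod :> nat -> gmodule G;
  pr_d : forall i, ghom (pr_mod i.+1) (pr_mod i);
  pr_aug : ghom (pr_mod 0) gtriv;
  pr_proj : forall i, gprojective (pr_mod i);
  pr_exact : forall i, exact_at (pr_d i.+1) (pr_d i);
  pr_exact0 : exact_at (pr_d 0) pr_aug;
  pr_surj : surj pr_aug }.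

(* Complexes of modules in degrees [>= 0]; [gc_d j] goes from degree [j.+1]
   to degree [j]. *)
Record gcomplex := GComplex {
  gc_mod :> nat -> gmodule G;
  gc_d : forall j, ghom (gc_mod j.+1) (gc_mod j);
  gc_dd : forall j x, gc_d j (gc_d j.+1 x) = 0 }.

Record gcmap (X Y : gcomplex) := GCMap {
  gcm :> forall j, ghom (X j) (Y j);
  gcm_d : forall j x, gcm j (gc_d X j x) = gc_d Y j (gcm j.+1 x) }.

(* [X] with the entries in the degrees outside [p] replaced by [0]. *)
Section Truncation.
Variable X : gcomplex.
Definition trunc_d (p : pred nat) j :
    ghom (gif (p j.+1) (X j.+1)) (gif (p j) (X j)) :=
  gcomp (gif_in (p j) (X j)) (gcomp (gc_d X j) (gif_out (p j.+1) (X j.+1))).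
Fact trunc_dd p j x : @trunc_d p j (@trunc_d p j.+1 x) = 0.
Proof.
rewrite /trunc_d /= gif_inK; case: ifP => _; last by rewrite !raddf0.
by rewrite gc_dd raddf0.
Qed.
Definition trunc (p : pred nat) : gcomplex := GComplex (@trunc_dd p).

Definition trunc_fun (p q : pred nat) j : ghom (trunc p j) (trunc q j) :=
  gcomp (gif_in (q j) (X j)) (gif_out (p j) (X j)).
Fact trunc_fun_d (p q : pred nat) (pq : forall j, p j.+1 -> q j -> p j = q j.+1)
  j x : @trunc_fun p q j (gc_d (trunc p) j x) =
        gc_d (trunc q) j (@trunc_fun p q j.+1 x).
Proof.
rewrite /= /trunc_fun /trunc_d /= !gif_inK.
have [pj|npj] : p j.+1 \/ p j.+1 = false by case: (p j.+1); [left|right].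
  have [qj|nqj] : q j \/ q j = false by case: (q j); [left|right].
    by rewrite (pq _ pj qj); case: ifP => _; rewrite ?raddf0.
  by rewrite !(gif_in0 _ nqj).
by rewrite (gif_out0 _ npj) raddf0; do 2! case: ifP => _; rewrite ?raddf0.
Qed.
Definition trunc_map p q pq : gcmap (trunc p) (trunc q) :=
  GCMap (@trunc_fun_d p q pq).
End Truncation.

End GModuleConstructions.

(* The tensor product over [ZG], which is commutative: both factors are left
   modules. *)

Section Tensor.
Variables (G : zmodType) (P M : gmodule G).

Inductive tens_rel : {freeg (P * M) / int} -> Prop :=
| tens_relDl p p' m :
    tens_rel (<< (p + p', m) >> - << (p, m) >> - << (p', m) >>)
| tens_relDr p m m' :
    tens_rel (<< (p, m + m') >> - << (p, m) >> - << (p, m') >>)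
| tens_relG g p m : tens_rel (<< (gact g p, m) >> - << (p, gact g m) >>).

Definition tens_rels_set (x : {freeg (P * M) / int}) : Prop :=
  forall S : subgroup {freeg (P * M) / int},
    (forall r, tens_rel r -> S r) -> S x.
Fact tens_rels0 : tens_rels_set 0. Proof. by move=> S _; exact: sg0. Qed.
Fact tens_relsB x y :
  tens_rels_set x -> tens_rels_set y -> tens_rels_set (x - y).
Proof. by move=> Ax Ay S AS; apply: sgB; [exact: Ax|exact: Ay]. Qed.
Definition tens_rels := Subgroup tens_rels0 tens_relsB.

Definition tens : zmodType := quot_by tens_rels.

Definition tens_of (p : P) (m : M) : tens := qcls tens_rels << (p, m) >>.
End Tensor.

Section TensorMap.
Variables (G : zmodType) (P P' M M' : gmodule G).
Variables (f : ghom P P') (h : ghom M M').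

Definition tens_pre : {freeg (P * M) / int} -> {freeg (P' * M') / int} :=
  fglift (fun pm => << (f pm.1, h pm.2) >>).

Fact tens_preU p m : tens_pre << (p, m) >> = << (f p, h m) >>.
Proof. by rewrite /tens_pre liftU scale1r. Qed.

Fact tens_preB : GRing.zmod_morphism tens_pre.
Proof. exact: lift_is_additive. Qed.
HB.instance Definition _ := GRing.isZmodMorphism.Build _ _ tens_pre tens_preB.

Fact tens_pre_rels x : tens_rels P M x -> tens_rels P' M' (tens_pre x).
Proof.
move=> hx S relS.
have T0 : S (tens_pre 0) by rewrite raddf0; exact: sg0.
have TB a b : S (tens_pre a) -> S (tens_pre b) -> S (tens_pre (a - b)).
  by rewrite raddfB; exact: sgB.
apply: (hx (@Subgroup _ (fun y => S (tens_pre y)) T0 TB)) => r [].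
- move=> p p' m /=; rewrite !tens_preB !tens_preU ghomD.
  exact/relS/tens_relDl.
- move=> p m m' /=; rewrite !tens_preB !tens_preU ghomD.
  exact/relS/tens_relDr.
- move=> g p m /=; rewrite !tens_preB !tens_preU !ghomG.
  exact/relS/tens_relG.
Qed.

Definition tens_map (c : tens P M) : tens P' M' :=
  qcls (tens_rels P' M') (tens_pre (qrepr c)).

Lemma tens_map_cls x :
  tens_map (qcls (tens_rels P M) x) = qcls (tens_rels P' M') (tens_pre x).
Proof. by apply/qclsE; rewrite -raddfB; apply/tens_pre_rels/qclsE/qreprK. Qed.

Lemma tens_map_of p m : tens_map (tens_of p m) = tens_of (f p) (h m).
Proof. by rewrite /tens_of tens_map_cls tens_preU. Qed.

Fact tens_mapB : GRing.zmod_morphism tens_map.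
Proof.
move=> c c'; rewrite -(qreprK c) -(qreprK c') -qclsB.
by rewrite !tens_map_cls raddfB qclsB.
Qed.
HB.instance Definition _ :=
  GRing.isZmodMorphism.Build (tens P M) (tens P' M') tens_map tens_mapB.
End TensorMap.

Section TensorLemmas.
Variable G : zmodType.
Implicit Types P M : gmodule G.

Lemma tens_ind P M (S : subgroup (tens P M)) :
  (forall p m, S (tens_of p m)) -> forall c, S c.
Proof.
move=> hS c; rewrite -(qreprK c); move: (qrepr c) => D.
have SD x y : S x -> S y -> S (x + y).
  by move=> Sx Sy; rewrite -[y]opprK -[- y]sub0r; do 2! apply: sgB => //; exact: sg0.
have SN x : S x -> S (- x) by move=> Sx; rewrite -sub0r; apply: sgB => //; exact: sg0.
have SMn x n : S x -> S (x *+ n).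
  by move=> Sx; elim: n => [|n IHn]; rewrite ?mulrS; [exact: sg0|exact: SD].
have SMz x (z : int) : S x -> S (x *~ z).
  by case: z => n Sx; [exact: SMn|exact/SN/SMn].
rewrite -(freeg_sumE D); elim: (dom D) => [|[p m] s IHs].
  by rewrite big_nil raddf0; exact: sg0.
rewrite big_cons raddfD; apply: SD => //.
have -> : << coeff (p, m) D *g (p, m) >> =
          << (p, m) >> *~ coeff (p, m) D :> {freeg (P * M) / int}.
  by rewrite freeg_mulz intz.
by rewrite raddfMz; apply: SMz; exact: hS.
Qed.

Lemma tens_map_ext P P' M M' (f f' : {additive tens P M -> tens P' M'}) :
  (forall p m, f (tens_of p m) = f' (tens_of p m)) -> forall c, f c = f' c.
Proof.
move=> ff' c.
have S0 : f 0 = f' 0 by rewrite !raddf0.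
have SB x y : f x = f' x -> f y = f' y -> f (x - y) = f' (x - y).
  by rewrite !raddfB => -> ->.
exact: (@tens_ind _ _ (@Subgroup _ (fun x => f x = f' x) S0 SB)).
Qed.

Lemma tens_map_comp (P P' P'' M M' M'' : gmodule G) (f : ghom P' P'')
  (f' : ghom P P') (h : ghom M' M'') (h' : ghom M M') c :
  tens_map f h (tens_map f' h' c) = tens_map (gcomp f f') (gcomp h h') c.
Proof.
apply: (@tens_map_ext _ _ _ _ (tens_map f h \o tens_map f' h') _ _ c) => p m /=.
by rewrite !tens_map_of.
Qed.

Lemma tens_map_eq (P P' M M' : gmodule G) (f f' : ghom P P')
  (h h' : ghom M M') c :
  f =1 f' -> h =1 h' -> tens_map f h c = tens_map f' h' c.
Proof.
move=> ff' hh'.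
apply: (@tens_map_ext _ _ _ _ (tens_map f h) (tens_map f' h')) => p m /=.
by rewrite !tens_map_of ff' hh'.
Qed.

Lemma tens_of0l (P M : gmodule G) (m : M) : tens_of (0 : P) m = 0.
Proof.
have : tens_of (0 + 0 : P) m - tens_of 0 m - tens_of 0 m = 0.
  rewrite /tens_of -!qclsB -(raddf0 (qcls (tens_rels P M))).
  by apply/qclsE; rewrite subr0 => S; apply; exact: tens_relDl.
by rewrite addr0 subrr sub0r => /eqP; rewrite oppr_eq0 => /eqP.
Qed.

Lemma tens_of0r (P M : gmodule G) (p : P) : tens_of p (0 : M) = 0.
Proof.
have : tens_of p (0 + 0 : M) - tens_of p 0 - tens_of p 0 = 0.
  rewrite /tens_of -!qclsB -(raddf0 (qcls (tens_rels P M))).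
  by apply/qclsE; rewrite subr0 => S; apply; exact: tens_relDr.
by rewrite addr0 subrr sub0r => /eqP; rewrite oppr_eq0 => /eqP.
Qed.

Lemma tens_map0l (P P' M M' : gmodule G) (f : ghom P P') (h : ghom M M') c :
  (forall p, f p = 0) -> tens_map f h c = 0.
Proof.
move=> f0; apply: (@tens_map_ext _ _ _ _ (tens_map f h) \0) => p m /=.
by rewrite tens_map_of f0 tens_of0l.
Qed.

Lemma tens_map0r (P P' M M' : gmodule G) (f : ghom P P') (h : ghom M M') c :
  (forall m, h m = 0) -> tens_map f h c = 0.
Proof.
move=> h0; apply: (@tens_map_ext _ _ _ _ (tens_map f h) \0) => p m /=.
by rewrite tens_map_of h0 tens_of0r.
Qed.
End TensorLemmas.

(* Complexes of abelian groups are internally graded: [dg_deg k] is the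
   degree-[k] part of [dg_car], and [dg_d] lowers the degree by one.  No
   degree then appears in the type of the differential. *)
Record dgroup := DGroup {
  dg_car :> zmodType;
  dg_d : dg_car -> dg_car;
  dg_dB : GRing.zmod_morphism dg_d;
  dg_deg : int -> subgroup dg_car;
  dg_dd : forall x, dg_d (dg_d x) = 0;
  dg_d_deg : forall k x, dg_deg k x -> dg_deg (k - 1) (dg_d x) }.

HB.instance Definition _ (X : dgroup) :=
  GRing.isZmodMorphism.Build X X (@dg_d X) (@dg_dB X).

Section Homology.
Variables (X : dgroup) (k : int).

Definition cyc_set (x : X) : Prop := dg_deg X k x /\ dg_d x = 0.
Fact cyc0 : cyc_set 0. Proof. by split; [exact: sg0|exact: raddf0]. Qed.
Fact cycB x y : cyc_set x -> cyc_set y -> cyc_set (x - y).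
Proof.
by move=> [? dx] [? dy]; split; [exact: sgB|rewrite dg_dB dx dy subrr].
Qed.
Definition cyc := Subgroup cyc0 cycB.

Definition bnd_set (x : X) : Prop := exists2 y, dg_deg X (k + 1) y & dg_d y = x.
Fact bnd0 : bnd_set 0. Proof. by exists 0; [exact: sg0|exact: raddf0]. Qed.
Fact bndB x y : bnd_set x -> bnd_set y -> bnd_set (x - y).
Proof.
move=> [x' ? <-] [y' ? <-].
by exists (x' - y'); [exact: sgB|exact: dg_dB].
Qed.
Definition bnd := Subgroup bnd0 bndB.

Definition homology : zmodType := subq cyc bnd.

Definition hcls (x : X) : homology := subq_cls cyc bnd x.
End Homology.

(* Maps of complexes lowering the degree by [r], up to sign. *)
Record chmap (X Y : dgroup) (r : int) := ChMap {
  ch_fun :> X -> Y;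
  chB : GRing.zmod_morphism ch_fun;
  ch_deg : forall k l x, k = l + r -> dg_deg X k x -> dg_deg Y l (ch_fun x);
  ch_d : exists e : bool, forall x, dg_d (ch_fun x) = ch_fun (dg_d x) *~ (-1) ^+ e }.

HB.instance Definition _ (X Y : dgroup) r (f : chmap X Y r) :=
  GRing.isZmodMorphism.Build X Y (ch_fun f) (@chB X Y r f).

Section HomologyMap.
Variables (X Y : dgroup) (r k l : int) (f : chmap X Y r) (e : k = l + r).

Fact ch_cyc x : cyc X k x -> cyc Y l (f x).
Proof.
move=> [xk dx]; split; first exact: ch_deg xk.
by have [s ->] := ch_d f; rewrite dx raddf0 mul0rz.
Qed.

Fact ch_bnd x : bnd X k x -> bnd Y l (f x).
Proof.
move=> [y yk <-]; have [s fd] := ch_d f.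
exists (f y *~ (-1) ^+ s).
  rewrite -raddfMz; apply: (@ch_deg _ _ _ f (k + 1)); first by rewrite e addrAC.
  by case: s {fd} => //; rewrite expr1 mulrN1z -sub0r; apply: sgB yk; exact: sg0.
by rewrite raddfMz /= fd -mulrzA -expr2 sqrr_sign.
Qed.

Definition hmap : homology X k -> homology Y l := subq_map ch_cyc ch_bnd.

HB.instance Definition _ := GRing.Additive.on hmap.

Lemma hmap_cls x : cyc X k x -> hmap (hcls k x) = hcls l (f x).
Proof. exact: subq_map_cls. Qed.
End HomologyMap.

Definition hmap0 (X Y : dgroup) (f : chmap X Y 0) (k : int) :
  homology X k -> homology Y k := hmap f (esym (addr0 k)).
Arguments hmap0 {X Y} f k _.

(* For a short exact sequence [X -f-> Y -g-> Z] this determines [del]: a class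
   [z] in degree [k] is lifted to [y], and [del] of it is the class of the [x]
   with [f x = dy]. *)
Definition is_connecting (X Y Z : dgroup) (f : chmap X Y 0) (g : chmap Y Z 0)
    (k l : int) (del : homology Z k -> homology X l) :=
  forall (x : X) (y : Y), cyc X l x -> dg_deg Y k y -> cyc Z k (g y) ->
    f x = dg_d y -> del (hcls k (g y)) = hcls l x.

Definition dprod (I : Type) (T : I -> zmodType) : Type := forall i, T i.

Section DProd.
Variables (I : Type) (T : I -> zmodType).
HB.instance Definition _ := gen_eqMixin (dprod T).
HB.instance Definition _ := gen_choiceMixin (dprod T).
Let add (x y : dprod T) : dprod T := fun i => x i + y i.
Let opp (x : dprod T) : dprod T := fun i => - x i.
Let zero : dprod T := fun i => 0.
Fact dprod_addA : associative add.
Proof. by move=> x y z; apply: functional_extensionality_dep => i; exact: addrA. Qed.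
Fact dprod_addC : commutative add.
Proof. by move=> x y; apply: functional_extensionality_dep => i; exact: addrC. Qed.
Fact dprod_add0 : left_id zero add.
Proof. by move=> x; apply: functional_extensionality_dep => i; exact: add0r. Qed.
Fact dprod_addN : left_inverse zero opp add.
Proof. by move=> x; apply: functional_extensionality_dep => i; exact: addNr. Qed.
HB.instance Definition _ := GRing.isZmodule.Build (dprod T)
  dprod_addA dprod_addC dprod_add0 dprod_addN.
Lemma dprodB (x y : dprod T) i : (x - y) i = x i - y i. Proof. by []. Qed.
Lemma dprod0 i : (0 : dprod T) i = 0. Proof. by []. Qed.
End DProd.

Section Coefficients.
Variables (G : zmodType) (P : proj_resolution G).

Section Module_.
Variable M : gmodule G.
Definition mc_car : zmodType := dprod (fun i : nat => tens (P i) M).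
Definition mc_d (z : mc_car) : mc_car :=
  fun i => tens_map (pr_d P i) (gid M) (z i.+1).
Fact mc_dB : GRing.zmod_morphism mc_d.
Proof.
move=> x y; apply: functional_extensionality_dep => i.
by rewrite /mc_d !dprodB raddfB.
Qed.
Definition mc_deg_set (k : int) (z : mc_car) : Prop :=
  forall i : nat, i%:Z != k -> z i = 0.
Fact mc_deg0 k : mc_deg_set k 0. Proof. by []. Qed.
Fact mc_degB k x y : mc_deg_set k x -> mc_deg_set k y -> mc_deg_set k (x - y).
Proof. by move=> xk yk i ik; rewrite dprodB xk // yk // subrr. Qed.
Definition mc_deg k : subgroup mc_car := Subgroup (@mc_deg0 k) (@mc_degB k).

Fact mc_dd z : mc_d (mc_d z) = 0.
Proof.
apply: functional_extensionality_dep => i.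
rewrite /mc_d tens_map_comp tens_map0l // => p.
by apply/pr_exact; exists p.
Qed.

Fact mc_d_deg k z : mc_deg k z -> mc_deg (k - 1) (mc_d z).
Proof.
move=> zk i ik; rewrite /mc_d zk ?raddf0 //.
by apply: contra ik => /eqP <-; rewrite -addn1 PoszD addrK.
Qed.

Definition mod_cplx : dgroup := DGroup mc_dB mc_dd mc_d_deg.
End Module_.

Section ModuleMap.
Variables (M N : gmodule G) (u : ghom M N).
Definition mod_map_fun (z : mod_cplx M) : mod_cplx N :=
  fun i => tens_map (gid (P i)) u (z i).
Fact mod_mapB : GRing.zmod_morphism mod_map_fun.
Proof.
move=> x y; apply: functional_extensionality_dep => i.
by rewrite /mod_map_fun !dprodB raddfB.
Qed.
Fact mod_map_deg k l x : k = l + 0 -> dg_deg (mod_cplx M) k x ->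
  dg_deg (mod_cplx N) l (mod_map_fun x).
Proof.
by rewrite addr0 => -> xl i il; rewrite /mod_map_fun xl ?raddf0.
Qed.
Fact mod_map_d : exists e : bool, forall x,
  dg_d (mod_map_fun x) = mod_map_fun (dg_d x) *~ (-1) ^+ e.
Proof.
exists false => x; rewrite expr0 mulr1z.
apply: functional_extensionality_dep => i.
by rewrite /= /mc_d /mod_map_fun !tens_map_comp; exact: tens_map_eq.
Qed.
Definition mod_map : chmap (mod_cplx M) (mod_cplx N) 0 :=
  ChMap mod_mapB mod_map_deg mod_map_d.
End ModuleMap.

(* The total complex of [P (x) X].  The differential of [p (x) x], with [x] in
   degree [j], is [(-1)^(s+j) dp (x) x + p (x) dx].  The global sign [(-1)^s]
   of the differential of [P] is a normalisation: the total complex of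
   [P (x) M[s]] is exactly [P (x) M], shifted.  The diagram uses [s = n]
   throughout; under other conventions its squares commute up to signs only. *)
Section Total.
Variables (s : nat) (X : gcomplex G).
Definition tot_car : zmodType :=
  dprod (fun ij : nat * nat => tens (P ij.1) (X ij.2)).
Definition tot_d (z : tot_car) : tot_car := fun ij =>
  tens_map (pr_d P ij.1) (gid (X ij.2)) (z (ij.1.+1, ij.2))
    *~ (-1) ^+ (s + ij.2)
  + tens_map (gid (P ij.1)) (gc_d X ij.2) (z (ij.1, ij.2.+1)).
Fact tot_dB : GRing.zmod_morphism tot_d.
Proof.
move=> x y; apply: functional_extensionality_dep => -[i j].
rewrite /tot_d !dprodB /= !raddfB mulrzBl opprD !addrA; congr (_ + _).
by rewrite -!addrA; congr (_ + _); rewrite addrC.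
Qed.
Definition tot_deg_set (k : int) (z : tot_car) : Prop :=
  forall i j : nat, (i + j)%N%:Z != k -> z (i, j) = 0.
Fact tot_deg0 k : tot_deg_set k 0. Proof. by []. Qed.
Fact tot_degB k x y :
  tot_deg_set k x -> tot_deg_set k y -> tot_deg_set k (x - y).
Proof. by move=> xk yk i j ijk; rewrite dprodB xk // yk // subrr. Qed.
Definition tot_deg k : subgroup tot_car := Subgroup (@tot_deg0 k) (@tot_degB k).

Fact tot_dd z : tot_d (tot_d z) = 0.
Proof.
apply: functional_extensionality_dep => -[i j].
rewrite /tot_d /= !raddfD /= !raddfMz /= !tens_map_comp.
rewrite mulrzDl [X in X *~ _ *~ _ + _]tens_map0l; last by move=> p; apply/pr_exact; exists p.
rewrite [X in _ + (_ + X)]tens_map0r; last by move=> m; exact: gc_dd.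
rewrite !mul0rz add0r addr0 addnS exprS mulN1r mulrNz.
by rewrite (@tens_map_eq _ _ _ _ _ _ (gcomp (gid (P i)) (pr_d P i)) _
     (gcomp (gc_d X j) (gid (X j.+1)))) // subrr.
Qed.

Fact tot_d_deg k z : tot_deg k z -> tot_deg (k - 1) (tot_d z).
Proof.
move=> zk i j ijk; have nk : (i + j).+1%:Z != k.
  by apply: contra ijk => /eqP <-; rewrite intS addrAC subrr add0r.
by rewrite /tot_d /= !zk ?addnS // !raddf0 mul0rz addr0.
Qed.

Definition tot : dgroup := DGroup tot_dB tot_dd tot_d_deg.
End Total.

Section TotalMap.
Variables (s : nat) (X Y : gcomplex G) (u : gcmap X Y).
Definition tot_map_fun (z : tot s X) : tot s Y :=
  fun ij => tens_map (gid (P ij.1)) (u ij.2) (z ij).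
Fact tot_mapB : GRing.zmod_morphism tot_map_fun.
Proof.
move=> x y; apply: functional_extensionality_dep => ij.
by rewrite /tot_map_fun !dprodB raddfB.
Qed.
Fact tot_map_deg k l x : k = l + 0 -> dg_deg (tot s X) k x ->
  dg_deg (tot s Y) l (tot_map_fun x).
Proof.
by rewrite addr0 => -> xl i j ijl; rewrite /tot_map_fun xl ?raddf0.
Qed.
Fact tot_map_d : exists e : bool, forall x,
  dg_d (tot_map_fun x) = tot_map_fun (dg_d x) *~ (-1) ^+ e.
Proof.
exists false => x; rewrite expr0 mulr1z.
apply: functional_extensionality_dep => -[i j].
rewrite /= /tot_d /tot_map_fun /= raddfD raddfMz /= !tens_map_comp.
congr (_ *~ _ + _).
by apply: tens_map_eq => // m /=; rewrite gcm_d.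
Qed.
Definition tot_map : chmap (tot s X) (tot s Y) 0 :=
  ChMap tot_mapB tot_map_deg tot_map_d.
End TotalMap.

(* The map [H_{k+r}(G; X) -> H_k(G; L)] induced by a map of complexes
   [X -> L[r]]. *)
Section TotalToModule.
Variables (s r : nat) (X : gcomplex G) (L : gmodule G) (u : ghom (X r) L).
Hypothesis ud : forall x, u (gc_d X r x) = 0.
Definition tot_mod_fun (z : tot s X) : mod_cplx L :=
  fun i => tens_map (gid (P i)) u (z (i, r)).
Fact tot_modB : GRing.zmod_morphism tot_mod_fun.
Proof.
move=> x y; apply: functional_extensionality_dep => i.
by rewrite /tot_mod_fun !dprodB raddfB.
Qed.
Fact tot_mod_deg k l x : k = l + r%:Z -> dg_deg (tot s X) k x ->
  dg_deg (mod_cplx L) l (tot_mod_fun x).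
Proof.
move=> -> xk i il; rewrite /tot_mod_fun xk ?raddf0 //.
by rewrite PoszD (inj_eq (addIr _)).
Qed.
Fact tot_mod_d : exists e : bool, forall x,
  dg_d (tot_mod_fun x) = tot_mod_fun (dg_d x) *~ (-1) ^+ e.
Proof.
exists (odd (s + r)) => x; apply: functional_extensionality_dep => i.
have mzE (z : mod_cplx L) (a : int) : (z *~ a) i = z i *~ a.
  have mnE n : (z *+ n) i = z i *+ n.
    by elim: n => // n IHn; rewrite !mulrS -IHn.
  by case: a => n; rewrite /intmul //= -mnE.
rewrite mzE signr_odd /= /mc_d /tot_mod_fun /= /tot_d /=.
rewrite raddfD raddfMz /= !tens_map_comp.
rewrite [X in _ + X]tens_map0r // addr0 -mulrzA -expr2 sqrr_sign mulr1z.
exact: tens_map_eq.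
Qed.
Definition tot_mod : chmap (tot s X) (mod_cplx L) r :=
  ChMap tot_modB tot_mod_deg tot_mod_d.
End TotalToModule.

End Coefficients.

Section Geometry.
Variables (R : realType) (N : nat).
Local Notation E := 'rV[R]_N.
Implicit Types (A P F : set E) (V U : {vspace E}) (r : nat).

Definition sumset A P : set E := [set a + p | a in A & p in P].

Definition affine_subspace V r A := exists (a : E) (U : {vspace E}),
  [/\ a \in V, (U <= V)%VS, \dim U = r & A = [set a + u | u in [set` U]]].

(* The direction of the affine span of [A]. *)
Definition dirv A : {vspace E} :=
  xget 0%VS [set U : {vspace E} | forall U' : {vspace E},
    (U <= U')%VS <-> forall x y, A x -> A y -> x - y \in U'].

Definition adim A : nat := \dim (dirv A).

Definition affspan A : set E := sumset A [set` dirv A].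

Definition dotp (u x : E) : R := (u *m x^T) 0 0.

Definition convex_polytope V P := [/\ P !=set0, compact P &
  exists k (u : 'I_k -> E) (c : 'I_k -> R),
    P = [set x | x \in V /\ forall i, dotp (u i) x <= c i]].

Definition polyhedron V r A := exists k (Q : 'I_k.+1 -> set E),
  [/\ forall i, convex_polytope V (Q i) /\ adim (Q i) = r,
      forall i j, affspan (Q i) = affspan (Q j) &
      A = \bigcup_i Q i].

(* The boundary of a subset [A] of [V], relative to [V]. *)
Definition bdry V A : set E := closure A `&` closure ([set` V] `\` A).

(* [F = P] is allowed (take [u = 0] and [c = 0]). *)
Definition face P F := F !=set0 /\ exists (u : E) (c : R),
  (forall x, P x -> dotp u x <= c) /\ F = P `&` [set x | dotp u x = c].

(* The affine spaces with direction [U] are oriented by [vbasis U], so that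
   the orientations are invariant under translation.  The incidence number of
   [F] and its facet [Q] compares the orientation of [F] with an outward
   vector followed by the orientation of [Q]. *)
Definition outward F Q : set E :=
  [set y - x | x in F & y in Q] `\` [set` dirv Q].

Definition incidence F Q : int :=
  let v := xget 0 (outward F Q) in
  let b : seq E := v :: vbasis (dirv Q) in
  sgz (\det (\matrix_(i < \dim (dirv F), j < \dim (dirv F))
    coord (vbasis (dirv F)) j b`_i)).

End Geometry.

(* [E^||] is [cp_par] and [E^perp] is [cp_perp]; the lattice is given by a
   basis, the rows of [cp_basis], and is identified with the group ['rV[int]_N]
   of integral coordinates. *)
Definition lat (R : realType) N (B : 'M[R]_N) (g : 'rV[int]_N) : 'rV[R]_N :=
  map_mx intr g *m B.

Record cut_project (R : realType) (N d n : nat) := CutProject {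
  cp_basis : 'M[R]_N;
  cp_basisP : cp_basis \in unitmx;
  cp_par : {vspace 'rV[R]_N};
  cp_perp : {vspace 'rV[R]_N};
  cp_full : (cp_par + cp_perp)%VS = fullv;
  cp_direct : (cp_par :&: cp_perp)%VS = 0%VS;
  cp_dim_par : \dim cp_par = d;
  cp_dim_perp : \dim cp_perp = n;
  cp_inj_par : injective (fun g => daddv_pi cp_par cp_perp (lat cp_basis g));
  cp_inj_perp : injective (fun g => daddv_pi cp_perp cp_par (lat cp_basis g));
  cp_dense_par :
    closure (range (fun g => daddv_pi cp_par cp_perp (lat cp_basis g)))
      = [set` cp_par];
  cp_dense_perp :
    closure (range (fun g => daddv_pi cp_perp cp_par (lat cp_basis g)))
      = [set` cp_perp];
  cp_window : set 'rV[R]_N;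
  cp_windowP : exists k (Q : 'I_k.+1 -> set 'rV[R]_N),
    (forall i, polyhedron cp_perp n (Q i)) /\ cp_window = \bigcup_i Q i;
  cp_nface : nat;
  cp_face : 'I_cp_nface -> set 'rV[R]_N;
  cp_faceP : forall i, polyhedron cp_perp n.-1 (cp_face i);
  cp_bdry : bdry cp_perp cp_window = \bigcup_i cp_face i }.

Arguments cp_face {R N d n} c i.

Section CutProject.
Variables (R : realType) (N d n : nat) (X : cut_project R N d n).
Local Notation E := 'rV[R]_N.
Local Notation Gamma := 'rV[int]_N.

Definition latE (g : Gamma) : E := lat (cp_basis X) g.
Definition pi_perp (g : Gamma) : E := daddv_pi (cp_perp X) (cp_par X) (latE g).
Definition Gamma_perp : set E := range pi_perp.

Definition almost_canonical :=
  forall i, affspan (cp_face X i) `<=` sumset (cp_face X i) Gamma_perp.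

Definition sing_set : set E :=
  sumset [set` cp_par X] (sumset (range latE) (bdry (cp_perp X) (cp_window X))).

Definition spans_sing_set k (W : 'I_k -> set E) :=
  (forall a, affine_subspace (cp_perp X) n.-1 (W a)) /\
  sing_set = sumset [set` cp_par X] (sumset Gamma_perp (\bigcup_a W a)).

Definition singular_family k (W : 'I_k -> set E) :=
  spans_sing_set W /\
  forall k' (W' : 'I_k' -> set E), spans_sing_set W' -> (k <= k')%N.

Section Functions.
Let act (g : Gamma) (f : E -> int) : E -> int := fun x => f (x - pi_perp g).
Fact pi_perp0 : pi_perp 0 = 0.
Proof. by rewrite /pi_perp /latE /lat map_mx0 mul0mx raddf0. Qed.
Fact pi_perpD g h : pi_perp (g + h) = pi_perp g + pi_perp h.
Proof. by rewrite /pi_perp /latE /lat map_mxD mulmxDl raddfD. Qed.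
Fact fun_act0 f : act 0 f = f.
Proof. by apply/funext => x; rewrite /act pi_perp0 subr0. Qed.
Fact fun_actD g h f : act (g + h) f = act g (act h f).
Proof. by apply/funext => x; rewrite /act pi_perpD opprD addrA. Qed.
Fact fun_actB g (f f' : E -> int) : act g (f - f') = act g f - act g f'.
Proof. by []. Qed.
Definition fun_mod : gmodule Gamma := GModule fun_act0 fun_actD fun_actB.
End Functions.

(* functions vanishing outside a set of dimension less than [r] *)
Section Negligible.
Variable r : nat.
Definition negl_set (f : fun_mod) : Prop := exists S : set (set E),
  [/\ finite_set S,
      forall A, S A -> exists2 r', (r' < r)%N & affine_subspace (cp_perp X) r' A &
      forall x, f x != 0 -> exists2 A, S A & A x].
Fact negl0 : negl_set 0.
Proof. by exists set0; split=> // x /eqP. Qed.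
Fact neglB f f' : negl_set f -> negl_set f' -> negl_set (f - f').
Proof.
move=> [S [finS dimS suppS]] [S' [finS' dimS' suppS']].
exists (S `|` S'); split=> [|A [/dimS//|/dimS'//]|x ffx].
  by rewrite finite_setU.
have [fx0|/suppS[A SA Ax]] := eqVneq (f x) 0; last by exists A => //; left.
have [f'x0|/suppS'[A SA Ax]] := eqVneq (f' x) 0; last by exists A => //; right.
have ffE : (f - f') x = f x - f' x :> int by [].
by move: ffx; rewrite ffE fx0 f'x0 subrr eqxx.
Qed.
Fact neglG g f : negl_set f -> negl_set (gact g f).
Proof.
move=> [S [finS dimS suppS]].
exists [set [set x | A (x - pi_perp g)] | A in S]; split.
- exact: finite_image.
- move=> _ [A SA <-]; have [r' r'r [a [U [aV UV dU ->]]]] := dimS _ SA.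
  exists r' => //; exists (a + pi_perp g), U; split=> //.
    by rewrite memvD // memv_pi.
  apply/seteqP; split=> x /=.
    by move=> [u uU aux]; exists u => //; rewrite addrAC aux subrK.
  by move=> [u uU <-]; exists u => //; rewrite [RHS]addrAC addrK.
- by move=> x /suppS[A SA Ax]; exists [set x | A (x - pi_perp g)] => //; exists A.
Qed.
Definition negl : submodule fun_mod :=
  @Submodule _ fun_mod (Subgroup negl0 neglB) neglG.
End Negligible.

Section Topes.
Variables (k : nat) (W : 'I_k -> set E).

Definition singular_space (H : set E) :=
  exists (a : 'I_k) (g : Gamma), H = [set x + pi_perp g | x in W a].

(* Only convex polyhedra are used: a compact polyhedron bounded by singular
   spaces is cut by them into convex ones, so the modules are the same. *)
Definition ctope (P : set E) :=
  [/\ convex_polytope (cp_perp X) P, adim P = n &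
      exists S : set (set E), [/\ finite_set S, S `<=` singular_space &
        bdry (cp_perp X) P `<=` \bigcup_(H in S) H]].

Definition ctope_facet r (F : set E) :=
  exists P, [/\ ctope P, face P F & adim F = r].

Definition indic_cls r (F : set E) : gquot (negl r) :=
  qcls (negl r) (\1_F : E -> int).

(* The module [C_r] is generated by the classes of indicator functions of
   facets; a cellular [r]-chain is turned into a function by the orientations
   of the [r]-dimensional spaces.  [C_r = 0] for [r > n]. *)
Definition Cmod r : gmodule Gamma :=
  gsub (gspan (M := gquot (negl r)) [set indic_cls r F | F in ctope_facet r]).

(* Meaningful for [ctope_facet r F]. *)
Definition cell r (F : set E) : Cmod r := insubd 0 (indic_cls r F).

(* The exact [Gamma]-equivariant complex
   [0 -> C_n -> ... -> C_0 -> Z -> 0] formed by the cellular boundary maps and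
   the augmentation.  [tc_exact] includes the injectivity of [C_n -> C_{n-1}],
   as [C_{n+1} = 0]. *)
Record tope_complex := TopeComplex {
  tc_bd : forall r, ghom (Cmod r.+1) (Cmod r);
  tc_aug : ghom (Cmod 0) (gtriv Gamma);
  tc_bdE : forall r F, ctope_facet r.+1 F -> tc_bd r (cell r.+1 F) =
    \sum_(Q \in [set Q | face F Q /\ adim Q = r]) cell r Q *~ incidence F Q;
  tc_augE : forall F, ctope_facet 0 F -> tc_aug (cell 0 F) = 1;
  tc_exact : forall r, exact_at (tc_bd r.+1) (tc_bd r);
  tc_exact0 : exact_at (tc_bd 0) tc_aug;
  tc_surj : surj tc_aug }.

Section Complexes.
Variable C : tope_complex.

Fact Ccplx_dd j x : tc_bd C j (tc_bd C j.+1 x) = 0.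
Proof. by apply/tc_exact; exists x. Qed.
Definition Ccplx : gcomplex Gamma := GComplex Ccplx_dd.

(* [Cker r] is [C_{r-1}^0] *)
Definition Cker r : gmodule Gamma :=
  match r with
  | 0 => gtriv Gamma
  | 1 => gsub (gker (tc_aug C))
  | r'.+2 => gsub (gker (tc_bd C r'))
  end.

Fact tc_bd_aug x : gker (tc_aug C) (tc_bd C 0 x).
Proof. by apply/tc_exact0; exists x. Qed.

Definition Ccores r : ghom (Cmod r) (Cker r) :=
  match r return ghom (Cmod r) (Cker r) with
  | 0 => tc_aug C
  | 1 => gcorestr tc_bd_aug
  | r'.+2 => gcorestr (S := gker (tc_bd C r')) (@Ccplx_dd r')
  end.

Lemma Ccores_bd r x : Ccores r (tc_bd C r x) = 0.
Proof.
case: r x => [|[|r]] x /=; first exact: tc_bd_aug.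
  by apply: val_inj; exact: Ccplx_dd.
by apply: val_inj; exact: Ccplx_dd.
Qed.
End Complexes.
End Topes.
End CutProject.

Section Diagram.
Variables (R : realType) (N d m k : nat) (X : cut_project R N d m.+1).
Variables (W : 'I_k -> set 'rV[R]_N) (C : tope_complex X W).
Variable P : proj_resolution 'rV[int]_N.
Local Notation n := m.+1.
Local Notation CC := (Ccplx C).

Definition Acplx := trunc CC (fun j => (j < n)%N).
Definition Tcplx := trunc CC (fun j => (j <= n)%N).
Definition Dcplx := trunc CC (fun j => (n.-1 <= j <= n)%N).
(* [C_r[r]] *)
Definition Cconc r := trunc CC (pred1 r).

Fact incl_AT_subproof j : (j.+1 < n)%N -> (j <= n)%N -> (j < n)%N = (j.+1 <= n)%N.
Proof. by []. Qed.
Definition incl_AT : gcmap Acplx Tcplx := trunc_map CC incl_AT_subproof.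

Fact proj_TC_subproof j : (j.+1 <= n)%N -> pred1 n j -> (j <= n)%N = pred1 n j.+1.
Proof. by move=> jn /eqP jE; rewrite jE ltnn in jn. Qed.
Definition proj_TC : gcmap Tcplx (Cconc n) := trunc_map CC proj_TC_subproof.

Fact proj_AC_subproof j :
  (j.+1 < n)%N -> pred1 n.-1 j -> (j < n)%N = pred1 n.-1 j.+1.
Proof. by move=> jn /eqP jE; rewrite jE ltnn in jn. Qed.
Definition proj_AC : gcmap Acplx (Cconc n.-1) := trunc_map CC proj_AC_subproof.

Fact proj_TD_subproof j :
  (j.+1 <= n)%N -> (n.-1 <= j <= n)%N -> (j <= n)%N = (n.-1 <= j.+1 <= n)%N.
Proof. by move=> jn /andP[mj jn']; rewrite jn jn' (leq_trans mj). Qed.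
Definition proj_TD : gcmap Tcplx Dcplx := trunc_map CC proj_TD_subproof.

(* [H_{*+r}(Gamma; C_r[r]) -> H_*(Gamma; C_r)], from the identity of [C_r] *)
Fact ident_conc_subproof r x :
  gif_out (pred1 r r) (CC r) (gc_d (Cconc r) r x) = 0.
Proof.
rewrite /= gif_inK eqxx (gif_out0 x) ?raddf0 //=.
by apply/negbTE; rewrite neq_ltn ltnSn orbT.
Qed.
Definition ident_conc r :
    chmap (tot P n (Cconc r)) (mod_cplx P (Cmod X W r)) r :=
  tot_mod P n (@ident_conc_subproof r).

(* [H_{*+n-1}(Gamma; D) -> H_*(Gamma; C_{n-2}^0)], from the boundary map
   [C_{n-1} -> C_{n-2}^0] *)
Definition Dcores : ghom (Dcplx n.-1) (Cker C n.-1) :=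
  gcomp (Ccores C n.-1) (gif_out (n.-1 <= n.-1 <= n)%N (CC n.-1)).
Fact ident_D_subproof x : Dcores (gc_d Dcplx n.-1 x) = 0.
Proof.
rewrite /Dcores /= gif_inK; case: ifP => _; first exact: Ccores_bd.
exact: raddf0.
Qed.
Definition ident_D : chmap (tot P n Dcplx) (mod_cplx P (Cker C n.-1)) n.-1 :=
  tot_mod P n ident_D_subproof.

Fact deg_pred (i : int) : i + n%:Z = i + 1 + n.-1%:Z.
Proof. by rewrite -addrA; congr (_ + _); rewrite /= -PoszD add1n. Qed.
Fact deg_pred1 (i : int) : i + n%:Z - 1 = i + n.-1%:Z.
Proof. by rewrite deg_pred addrAC addrK. Qed.

Local Notation HT Y := (homology (tot P n Y)).
Local Notation HM M := (homology (mod_cplx P M)).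

Definition vert_A (i : int) : HT Acplx (i + n%:Z) -> HM (Cmod X W n.-1) (i + 1) :=
  hmap (ident_conc n.-1) (deg_pred i) \o hmap0 (tot_map P n proj_AC) (i + n%:Z).
Definition vert_A1 (i : int) : HT Acplx (i + n%:Z - 1) -> HM (Cmod X W n.-1) i :=
  hmap (ident_conc n.-1) (deg_pred1 i)
    \o hmap0 (tot_map P n proj_AC) (i + n%:Z - 1).
Definition vert_T (i : int) : HT Tcplx (i + n%:Z) -> HM (Cker C n.-1) (i + 1) :=
  hmap ident_D (deg_pred i) \o hmap0 (tot_map P n proj_TD) (i + n%:Z).
Definition vert_C (i : int) : HT (Cconc n) (i + n%:Z) -> HM (Cmod X W n) i :=
  hmap (ident_conc n) erefl.

End Diagram.

Arguments vert_A {R N d m k X W} C P i _.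
Arguments vert_A1 {R N d m k X W} C P i _.
Arguments vert_T {R N d m k X W} C P i _.
Arguments vert_C {R N d m k X W} C P i _.

(* Main.v *)
Require Import Defs.
From HB Require Import structures.
From mathcomp Require Import all_boot all_order all_algebra.
From mathcomp Require Import all_classical all_reals.
From mathcomp.multinomials Require Import freeg.

(** The diagram compares two long exact sequences, and everything is proved on
    the level of chains.

    Rows.  A projective [ZG]-module is flat ([projective_tens_inj]): a
    projective module is a retract of a free one, and tensoring with a free
    module on [B] amounts to taking a direct sum of copies indexed by [B].
    Together with right exactness ([tens_map_exact]) this shows that the
    resolution [P] turns short exact sequences of modules or of complexes of
    modules into short exact sequences of complexes of abelian groups, which
    have long exact homology sequences ([long_exact_sequence]).  For the top
    row the coefficient sequence is split in each degree.  For the bottom row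
    the exactness of [0 -> C_n -> C_(n-1) -> C_(n-2)^0 -> 0] is that of the
    complex of facets, the injectivity of the first map coming from
    [C_(n+1) = 0]: no polytope in [E^perp] has a facet of dimension greater
    than [n = dim E^perp] ([Cmod_eq0]).

    Identifications.  The complex [C_r[r]] is a resolution of [C_r] of length
    zero, and by the previous sequence the complex [C_n -> C_(n-1)] is a
    resolution of [C_(n-2)^0].  In both cases the map from the total complex
    to [P (x) L] is onto with acyclic kernel ([tot_mod_bijective]), hence an
    isomorphism in homology ([acyclic_kernel_hmap_bijective]).

    Squares.  Every vertical map reads off one column of the double complex,
    that is, the components in [P_i (x) X_j] for one fixed [j]
    ([vert_A_cls], [vert_T_cls], [vert_C_cls]).  For a chain [y] of the total
    complex of [T] with columns [y_j], the column [n-1] of [dy] is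
    [bd y_n - d y_(n-1)] ([tot_col_dE]).  If [y] is a cycle, this says that
    [y_(n-1)] lifts a representative of [vert_T y] and that [y_n]
    represents the class to which the bottom connecting map sends it.  If only the image of [y] in
    [P (x) C_n[n]] is a cycle, then [dy] comes from [A], and the identity says
    that the column of [dy] and [bd y_n] are homologous.  These are the two
    squares with connecting maps. *)

Set Implicit Arguments.
Unset Strict Implicit.
Unset Printing Implicit Defensive.

Import GRing.Theory.
Local Open Scope classical_set_scope.
Local Open Scope ring_scope.

(** * Subgroups and additive maps *)

Section Subgroups.
Variables (M : zmodType) (S : subgroup M).

Lemma sgN x : S x -> S (- x).
Proof. by move=> Sx; rewrite -sub0r; apply: sgB Sx; exact: sg0. Qed.

Lemma sgD x y : S x -> S y -> S (x + y).
Proof. by move=> Sx Sy; rewrite -[y]opprK; apply: sgB => //; exact: sgN. Qed.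

Lemma sgMz x (z : int) : S x -> S (x *~ z).
Proof.
have Sn n : S x -> S (x *+ n).
  by move=> Sx; elim: n => [|n IHn]; rewrite ?mulrS; [exact: sg0|exact: sgD].
by case: z => n Sx; [exact: Sn|exact/sgN/Sn].
Qed.
End Subgroups.

Section RangeEqualizer.
Variables (M N : zmodType) (f g : {additive M -> N}).

Fact sg_range0 : exists x, f x = 0. Proof. by exists 0; rewrite raddf0. Qed.
Fact sg_rangeB y y' : (exists x, f x = y) -> (exists x, f x = y') ->
  exists x, f x = y - y'.
Proof. by move=> [x <-] [x' <-]; exists (x - x'); rewrite raddfB. Qed.
Definition sg_range : subgroup N :=
  @Subgroup N (fun y => exists x, f x = y) sg_range0 sg_rangeB.

Fact sg_equalizer0 : f 0 = g 0. Proof. by rewrite !raddf0. Qed.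
Fact sg_equalizerB x y : f x = g x -> f y = g y -> f (x - y) = g (x - y).
Proof. by rewrite !raddfB => -> ->. Qed.
Definition sg_equalizer : subgroup M :=
  @Subgroup M (fun x => f x = g x) sg_equalizer0 sg_equalizerB.
End RangeEqualizer.

(** Gives maps that are built inside a proof their additive structure. *)
Lemma zmod_morphism_additive (A B : zmodType) (f : A -> B) :
  GRing.zmod_morphism f -> exists f' : {additive A -> B}, f' = f :> (A -> B).
Proof.
move=> fB.
by exists (HB.pack_for {additive A -> B} f
  (GRing.isZmodMorphism.Build A B f fB)).
Qed.

Section FreeExtension.
Variables (K : choiceType) (A : zmodType).

Lemma freeg_ind (S : subgroup {freeg K / int}) :
  (forall k, S << k >>) -> forall D, S D.
Proof.
move=> SK D; rewrite -(freeg_sumE D); elim: (dom D) => [|k s IHs].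
  by rewrite big_nil; exact: sg0.
rewrite big_cons; apply: sgD => //.
have -> : << coeff k D *g k >> = << k >> *~ coeff k D :> {freeg K / int}.
  by rewrite freeg_mulz intz.
exact: sgMz.
Qed.

Lemma freeg_extension (f : K -> A) :
  exists F : {additive {freeg K / int} -> A}, forall k, F << k >> = f k.
Proof.
have [F FE] :=
  zmod_morphism_additive (@lift_is_additive int K (zmodule A) f).
by exists F => k; rewrite FE liftU scale1r.
Qed.
End FreeExtension.

(** * The tensor product over the group ring *)

Section TensorProduct.
Variable G : zmodType.
Implicit Types P M N L : gmodule G.

Lemma tens_ofDl P M (p p' : P) (m : M) :
  tens_of (p + p') m = tens_of p m + tens_of p' m.
Proof.
apply/eqP; rewrite -subr_eq0 opprD addrA; apply/eqP.
rewrite /tens_of -!qclsB -(raddf0 (qcls (tens_rels P M))).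
by apply/qclsE; rewrite subr0 => S; apply; exact: tens_relDl.
Qed.

Lemma tens_ofDr P M (p : P) (m m' : M) :
  tens_of p (m + m') = tens_of p m + tens_of p m'.
Proof.
apply/eqP; rewrite -subr_eq0 opprD addrA; apply/eqP.
rewrite /tens_of -!qclsB -(raddf0 (qcls (tens_rels P M))).
by apply/qclsE; rewrite subr0 => S; apply; exact: tens_relDr.
Qed.

Lemma tens_ofG P M g (p : P) (m : M) :
  tens_of (gact g p) m = tens_of p (gact g m).
Proof. by apply/qclsE => S; apply; exact: tens_relG. Qed.

Lemma tens_of_zmodr P M (p : P) : GRing.zmod_morphism (@tens_of G P M p).
Proof.
by move=> m m'; apply/eqP; rewrite eq_sym subr_eq eq_sym -tens_ofDr subrK.
Qed.

Lemma tens_of_zmodl P M (m : M) :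
  GRing.zmod_morphism (fun p : P => tens_of p m).
Proof.
by move=> p p'; apply/eqP; rewrite eq_sym subr_eq eq_sym -tens_ofDl subrK.
Qed.

(** The universal property of the tensor product, used to define every map out
    of it that is not induced by maps of the factors. *)
Lemma tens_lift P M (A : zmodType) (b : P -> M -> A) :
  (forall p p' m, b (p + p') m = b p m + b p' m) ->
  (forall p m m', b p (m + m') = b p m + b p m') ->
  (forall g p m, b (gact g p) m = b p (gact g m)) ->
  exists F : {additive tens P M -> A}, forall p m, F (tens_of p m) = b p m.
Proof.
move=> bDl bDr bG.
have [f fE] := freeg_extension (fun pm => b pm.1 pm.2).
have frel x : tens_rels P M x -> f x = 0.
  apply: (_ : tens_rels P M x -> sg_equalizer f \0 x); apply=> r [] *.
  - by rewrite /= !raddfB /= !fE /= bDl addrAC addrK subrr.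
  - by rewrite /= !raddfB /= !fE /= bDr addrAC addrK subrr.
  - by rewrite /= !raddfB /= !fE /= bG subrr.
have Fcls x : f (qrepr (qcls (tens_rels P M) x)) = f x.
  by apply/eqP; rewrite -subr_eq0 -raddfB; apply/eqP/frel/qclsE/qreprK.
have FB : GRing.zmod_morphism (fun t : tens P M => f (qrepr t)).
  by move=> t t'; rewrite -(qreprK t) -(qreprK t') -qclsB !Fcls raddfB.
have [F FE] := zmod_morphism_additive FB.
by exists F => p m; rewrite FE Fcls fE.
Qed.

Lemma tens_additive_ext P M (A : zmodType) (f g : {additive tens P M -> A}) :
  (forall p m, f (tens_of p m) = g (tens_of p m)) -> f =1 g.
Proof. by move=> fg; exact: (tens_ind (S := sg_equalizer f g)). Qed.

Lemma tens_map_gid P M : tens_map (gid P) (gid M) =1 id.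
Proof.
move=> c.
apply: (@tens_additive_ext _ _ _ (tens_map (gid P) (gid M)) idfun) => p m.
by rewrite /= tens_map_of.
Qed.

Lemma tens_map_surj P M N (v : ghom M N) :
  Defs.surj v -> Defs.surj (tens_map (gid P) v).
Proof.
move=> vs; apply: (tens_ind (S := sg_range (tens_map (gid P) v))) => p n.
by have [m <-] := vs n; exists (tens_of p m); rewrite /= tens_map_of.
Qed.

(** Right exactness.  An arbitrary section [s] of [v] gives a map
    [p (x) l |-> p (x) s l] from [P (x) L] to the cokernel of [P (x) u]; it is
    well defined because two lifts of [l] differ by an element of the image
    of [u].  It inverts the map that [P (x) v] induces on this cokernel. *)
Lemma tens_map_exact P M N L (u : ghom M N) (v : ghom N L) :
  exact_at u v -> Defs.surj v ->
  exact_at (tens_map (gid P) u) (tens_map (gid P) v).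
Proof.
move=> uv vs t; split=> [|[x <-]]; last first.
  by rewrite tens_map_comp tens_map0r // => m; apply/uv; exists m.
have [s sK] := choice vs.
pose S := sg_range (tens_map (gid P) u).
have im p n n' : v n = v n' ->
    qcls S (tens_of p n) = qcls S (tens_of p n').
  move=> vnn'; apply/qclsE; rewrite -tens_of_zmodr.
  have [|m <-] := (uv (n - n')).1; first by rewrite ghomB vnn' subrr.
  by exists (tens_of p m); rewrite /= tens_map_of.
have [|||F FE] := @tens_lift P L _ (fun p l => qcls S (tens_of p (s l))).
- by move=> p p' l; rewrite tens_ofDl raddfD.
- move=> p l l'; rewrite -raddfD -tens_ofDr; apply: im.
  by rewrite ghomD !sK.
- by move=> g p l; rewrite tens_ofG; apply: im; rewrite ghomG !sK.
(* F composed with P (x) v is the projection to the cokernel of P (x) u *)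
have FvE : F \o tens_map (gid P) v =1 qcls S.
  by apply: tens_additive_ext => p n; rewrite /= tens_map_of FE; exact: im.
move=> vt; have := FvE t; rewrite /= vt raddf0 -(raddf0 (qcls S)).
by move/esym/qclsE; rewrite subr0.
Qed.
End TensorProduct.

HB.instance Definition _ (G : zmodType) (M : gmodule G) (g : G) :=
  GRing.isZmodMorphism.Build M M (@gact G M g) (@gactB G M g).

(** * Flatness of projective modules *)

Section FreeModule.
Variables (G : zmodType) (B : choiceType).

Definition free_shift (g : G) :
    {freeg (G * B) / int} -> {freeg (G * B) / int} :=
  fglift (fun hb => << (g + hb.1, hb.2) >>).

Fact free_shiftU g h b : free_shift g << (h, b) >> = << (g + h, b) >>.
Proof. by rewrite /free_shift liftU scale1r. Qed.

Fact free_shiftB g : GRing.zmod_morphism (free_shift g).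
Proof. exact: lift_is_additive. Qed.
HB.instance Definition _ g :=
  GRing.isZmodMorphism.Build _ _ (free_shift g) (free_shiftB g).

Fact free_shift0 x : free_shift 0 x = x.
Proof.
apply: (freeg_ind (S := sg_equalizer (free_shift 0) idfun)) => -[h b].
by rewrite /= free_shiftU add0r.
Qed.

Fact free_shiftD g h x : free_shift (g + h) x = free_shift g (free_shift h x).
Proof.
apply: (freeg_ind
  (S := sg_equalizer (free_shift (g + h)) (free_shift g \o free_shift h))).
by move=> [h' b]; rewrite /= !free_shiftU addrA.
Qed.

(** The free [ZG]-module on [B]; the basis element [(g, b)] of its underlying
    abelian group is [g b]. *)
Definition free_gmod : gmodule G := GModule free_shift0 free_shiftD free_shiftB.

Section Evaluation.
Variables (M : gmodule G) (f : B -> M).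

Definition free_eval_fun : free_gmod -> M :=
  fglift (M := zmodule M) (fun gb => gact gb.1 (f gb.2)).

Fact free_eval_funU g b : free_eval_fun << (g, b) >> = gact g (f b).
Proof. by rewrite /free_eval_fun liftU scale1r. Qed.

Fact free_evalB : GRing.zmod_morphism free_eval_fun.
Proof. exact: (@lift_is_additive int _ (zmodule M)). Qed.
HB.instance Definition _ :=
  GRing.isZmodMorphism.Build _ _ free_eval_fun free_evalB.

Fact free_evalG g x : free_eval_fun (gact g x) = gact g (free_eval_fun x).
Proof.
apply: (freeg_ind (S := sg_equalizer
  (free_eval_fun \o free_shift g) (gact g \o free_eval_fun))) => -[h b].
by rewrite /= free_shiftU !free_eval_funU gactD.
Qed.

Definition free_eval : ghom free_gmod M := GHom free_evalB free_evalG.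
End Evaluation.

Section Coordinates.
Variable M : gmodule G.
Implicit Types (m : M) (b : B) (x : free_gmod).

(** The component at [b] of [x (x) m] under the isomorphism of [F (x) M] with
    the direct sum of the copies of [M] indexed by [B], where [F] is free on
    [B]: as [(g b) (x) m = b (x) g m], this component is [g m] for
    [x = g b]. *)
Definition free_coord m b : free_gmod -> M :=
  fglift (M := zmodule M)
    (fun gb => if gb.2 == b then gact gb.1 m else 0).

Fact free_coordU m b g b' :
  free_coord m b << (g, b') >> = if b' == b then gact g m else 0.
Proof. by rewrite /free_coord liftU scale1r. Qed.

Fact free_coordB m b : GRing.zmod_morphism (free_coord m b).
Proof. exact: (@lift_is_additive int _ (zmodule M)). Qed.
HB.instance Definition _ m b :=
  GRing.isZmodMorphism.Build _ _ (free_coord m b) (free_coordB m b).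

Lemma free_coordD m m' b x :
  free_coord (m + m') b x = free_coord m b x + free_coord m' b x.
Proof.
apply: (freeg_ind (S := sg_equalizer (free_coord (m + m') b)
  (free_coord m b \+ free_coord m' b))) => -[g b'] /=.
by rewrite !free_coordU; case: eqP => _; rewrite ?addr0 ?raddfD.
Qed.

Lemma free_coordG m b g x :
  free_coord m b (gact g x) = free_coord (gact g m) b x.
Proof.
apply: (freeg_ind (S := sg_equalizer (free_coord m b \o free_shift g)
  (free_coord (gact g m) b))) => -[h b'] /=.
by rewrite free_shiftU !free_coordU -gactD addrC.
Qed.
End Coordinates.

Lemma free_coord_hom (M N : gmodule G) (u : ghom M N) m b x :
  u (free_coord m b x) = free_coord (u m) b x.
Proof.
apply: (freeg_ind (S := sg_equalizer (u \o free_coord m b)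
  (free_coord (u m) b))) => -[g b'] /=.
by rewrite !free_coordU; case: eqP => _; rewrite ?ghomG ?raddf0.
Qed.
End FreeModule.

Section Flatness.
Variables (G : zmodType) (Q : gmodule G).

(** [t] is the sum of the [b (x) c b].  Only finitely many terms of the family
    are meant to contribute; asking for all large finite sets of indices,
    instead of a support, makes the property stable under differences. *)
Definition tens_decomposition (M : gmodule G) (t : tens Q M) (c : Q -> M) :=
  exists s : seq Q, forall s', uniq s' -> {subset s <= s'} ->
    t = \sum_(b <- s') tens_of b (c b).

Lemma tens_decomposition0 (M : gmodule G) :
  @tens_decomposition M 0 (fun=> 0).
Proof. by exists [::] => s' _ _; rewrite big1 // => b _; rewrite tens_of0r. Qed.

Lemma tens_decompositionB (M : gmodule G) (t t' : tens Q M) c c' :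
  tens_decomposition t c -> tens_decomposition t' c' ->
  tens_decomposition (t - t') (fun b => c b - c' b).
Proof.
move=> [s tE] [s' t'E]; exists (s ++ s') => r ur sr.
rewrite (tE r) ?(t'E r) //.
- by rewrite -sumrB; apply: eq_bigr => b _; rewrite tens_of_zmodr.
- by move=> b bs'; apply: sr; rewrite mem_cat bs' orbT.
- by move=> b bs; apply: sr; rewrite mem_cat bs.
Qed.

Section CoordinateFamily.
Variables (M : gmodule G) (A : zmodType).
Variables (f : {additive A -> tens Q M}) (c : Q -> {additive A -> M}).

Fact decomposed0 : tens_decomposition (f 0) (fun b => c b 0).
Proof.
rewrite raddf0 (_ : (fun b => _) = fun=> 0); first exact: tens_decomposition0.
by apply/funext => b; rewrite raddf0.
Qed.

Fact decomposedB x y : tens_decomposition (f x) (fun b => c b x) ->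
  tens_decomposition (f y) (fun b => c b y) ->
  tens_decomposition (f (x - y)) (fun b => c b (x - y)).
Proof.
rewrite raddfB (_ : (fun b => c b (x - y)) = fun b => c b x - c b y).
  exact: tens_decompositionB.
by apply/funext => b; rewrite raddfB.
Qed.

Definition sg_decomposed : subgroup A := Subgroup decomposed0 decomposedB.
End CoordinateFamily.

Lemma free_eval_id_surj : Defs.surj (free_eval (@id Q)).
Proof. by move=> q; exists << (0, q) >>; rewrite /= free_eval_funU gact0. Qed.

(** An element [p = sum g b] of [Q], written as the value of a formal sum [x],
    satisfies [p (x) m = sum b (x) g m]. *)
Lemma free_eval_tens_decomposition (M : gmodule G) (m : M) (x : free_gmod G Q) :
  tens_decomposition (tens_of (free_eval (@id Q) x) m)
    (fun b => free_coord m b x).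
Proof.
have tB : GRing.zmod_morphism
    (fun x : free_gmod G Q => tens_of (free_eval (@id Q) x) m).
  by move=> y z; rewrite ghomB (tens_of_zmodl m).
have [t tE] := zmod_morphism_additive tB.
suff : tens_decomposition (t x) (fun b => free_coord m b x) by rewrite tE.
apply: (freeg_ind (S := sg_decomposed t (fun b => free_coord m b))) => -[g b0].
exists [:: b0] => s us b0s; rewrite tE.
rewrite (bigD1_seq b0) ?b0s ?mem_head //= big1 ?addr0.
  by rewrite free_eval_funU free_coordU eqxx tens_ofG.
by move=> b bb0; rewrite free_coordU eq_sym (negPf bb0) tens_of0r.
Qed.

(** Choose a section [h] of the surjection from the free module on the set [Q]
    onto [Q].  The coordinates of [h p] give, for each [b : Q], a map
    [F_b : Q (x) L -> L], natural in [L], such that every [t] in [Q (x) L] is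
    the sum of the [b (x) F_b t] (a dual basis of [Q]).  If [Q (x) u] kills
    [t], then [u] kills all the [F_b t] by naturality; they vanish as [u] is
    injective, and so does [t]. *)
Lemma projective_tens_inj (M N : gmodule G) (u : ghom M N) :
  gprojective Q -> injective u -> injective (tens_map (gid Q) u).
Proof.
move=> Qproj uI.
have [h hK] := Qproj _ _ _ free_eval_id_surj (gid Q).
have coordP (L : gmodule G) : exists F : Q -> {additive tens Q L -> L},
    forall b p m, F b (tens_of p m) = free_coord m b (h p).
  suff cF b : exists F : {additive tens Q L -> L},
      forall p m, F (tens_of p m) = free_coord m b (h p).
    by have [F FE] := choice cF; exists F.
  apply: tens_lift => [p p' m|p m m'|g p m].
  - by rewrite ghomD raddfD.
  - exact: free_coordD.
  - by rewrite ghomG free_coordG.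
have [FM FME] := coordP M; have [FN FNE] := coordP N.
have Fu b t : FN b (tens_map (gid Q) u t) = u (FM b t).
  apply: (tens_additive_ext (f := FN b \o tens_map (gid Q) u)
    (g := u \o FM b)) => p m.
  by rewrite /= tens_map_of FNE FME free_coord_hom.
have dec t : tens_decomposition t (fun b => FM b t).
  apply: (tens_ind (S := sg_decomposed idfun FM)) => p m.
  rewrite /= (_ : (fun b => _) = fun b => free_coord m b (h p)).
    by have := free_eval_tens_decomposition m (h p); rewrite hK.
  by apply/funext => b; rewrite FME.
apply: raddf_inj => t ut0; have [s tE] := dec t.
rewrite (tE (undup s)) ?undup_uniq // => [|b]; last by rewrite mem_undup.
rewrite big1 // => b _; rewrite [FM b t](_ : _ = 0) ?tens_of0r //.
by apply: uI; rewrite -Fu ut0 !raddf0.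
Qed.
End Flatness.

Lemma inj_surj_bijective (A B : Type) (f : A -> B) :
  injective f -> Defs.surj f -> bijective f.
Proof.
move=> fI fs; have [h hK] := choice fs; exists h => // x.
by apply: fI; rewrite hK.
Qed.

(** * Homology of complexes of abelian groups *)

Section HomologyClasses.
Variables (X : dgroup) (k : int).
Implicit Types x y : X.

Lemma hclsP (c : homology X k) : exists2 x, cyc X k x & hcls k x = c.
Proof. by exists (subq_repr c); [exact: subq_reprP|exact: subq_reprK]. Qed.

Lemma hcls_eqP x y : cyc X k x -> cyc X k y ->
  hcls k x = hcls k y <-> bnd X k (x - y).
Proof. exact: subq_clsE. Qed.

Lemma hclsB x y : cyc X k x -> cyc X k y ->
  hcls k (x - y) = hcls k x - hcls k y.
Proof. exact: subq_clsB. Qed.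

Lemma hcls0 : hcls k (0 : X) = 0.
Proof. by rewrite -[X in hcls _ X](subrr 0) hclsB ?subrr //; exact: sg0. Qed.

Lemma hcls_eq0P x : cyc X k x -> hcls k x = 0 <-> bnd X k x.
Proof.
move=> Zx; rewrite -hcls0 hcls_eqP ?subr0 //; exact: sg0.
Qed.
End HomologyClasses.

Section ChainMap.
Variables (X Y : dgroup) (r : int) (f : chmap X Y r).

(** A map of complexes commutes with the differentials up to a sign, which is
    absorbed into the argument here. *)
Lemma chmap_d x : exists2 x', (forall k, dg_deg X k x -> dg_deg X k x') &
  dg_d (f x) = f (dg_d x').
Proof.
have [e fd] := ch_d f; exists (x *~ (-1) ^+ e).
  by move=> k; exact: sgMz.
by rewrite fd !raddfMz.
Qed.

Lemma chmap_dV x : exists2 x', (forall k, dg_deg X k x -> dg_deg X k x') &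
  f (dg_d x) = dg_d (f x').
Proof.
have [e fd] := ch_d f; exists (x *~ (-1) ^+ e).
  by move=> k; exact: sgMz.
by rewrite fd !raddfMz /= -mulrzA -expr2 sqrr_sign.
Qed.

Lemma chmap_d_eq0 x : dg_d (f x) = 0 <-> f (dg_d x) = 0.
Proof.
have [e ->] := ch_d f; split=> [|->]; last by rewrite mul0rz.
case: e; rewrite ?expr0 ?expr1 ?mulr1z // mulrN1z => /eqP.
by rewrite oppr_eq0 => /eqP.
Qed.

Hypothesis f_surj : forall k l y, k = l + r -> dg_deg Y l y ->
  exists2 x, dg_deg X k x & f x = y.
Hypothesis ker_acyclic : forall k x, dg_deg X k x -> dg_d x = 0 -> f x = 0 ->
  exists2 b, dg_deg X (k + 1) b & f b = 0 /\ dg_d b = x.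

(** A cycle [y] has a preimage [x]; its boundary [dx] is a cycle of the kernel,
    hence [dx = db] with [b] in the kernel, and [x - b] is a cycle over [y].
    If a cycle [x] maps to a boundary, subtracting the boundary of a lift
    moves it into the kernel, where it is a boundary. *)
Lemma acyclic_kernel_hmap_bijective k l (e : k = l + r) :
  bijective (hmap f e).
Proof.
apply: inj_surj_bijective.
  apply: raddf_inj => c; have [x Zx <-] := hclsP c.
  rewrite /= hmap_cls // => /hcls_eq0P -[|w wl dw]; first exact: ch_cyc Zx.
  have kl : k + 1 = l + 1 + r by rewrite e addrAC.
  have [v vk vw] := f_surj kl wl.
  have [v' vv' dv'] := chmap_d v.
  have fx : f (x - dg_d v') = 0 by rewrite raddfB /= -dv' vw dw subrr.
  have [|||b bk [fb db]] := @ker_acyclic k (x - dg_d v').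
  - apply: sgB; first by case: Zx.
    by rewrite -(addrK 1 k); apply/dg_d_deg/vv'.
  - by rewrite raddfB /= dg_dd subr0; case: Zx.
  - by [].
  apply/hcls_eq0P => //; exists (b + v'); first by apply: sgD => //; exact: vv'.
  by rewrite raddfD /= db subrK.
move=> c; have [y [yl dy] <-] := hclsP c.
have [x xk fx] := f_surj e yl.
have fdx : f (dg_d x) = 0 by apply/chmap_d_eq0; rewrite fx.
have [||b bk [fb db]] := @ker_acyclic (k - 1) (dg_d x) _ _ fdx.
- exact: dg_d_deg.
- exact: dg_dd.
rewrite subrK in bk.
have Zxb : cyc X k (x - b).
  by split; [exact: sgB|rewrite raddfB /= db subrr].
by exists (hcls k (x - b)); rewrite hmap_cls // raddfB /= fb subr0 fx.
Qed.
End ChainMap.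

Lemma hmap0_cls (X Y : dgroup) (f : chmap X Y 0) k x :
  cyc X k x -> hmap0 f k (hcls k x) = hcls k (f x).
Proof. exact: hmap_cls. Qed.

(** A short exact sequence of internally graded complexes.  Since the maps are
    given on the ungraded groups, their compatibility with the gradings has to
    be demanded: [f] detects degrees, and homogeneous elements lift to
    homogeneous ones. *)
Record chain_short_exact (X Y Z : dgroup) (f : chmap X Y 0) (g : chmap Y Z 0) :=
  ChainShortExact {
  cse_inj : injective f;
  cse_exact : exact_at f g;
  cse_deg : forall k x, dg_deg Y k (f x) -> dg_deg X k x;
  cse_surj : forall k z, dg_deg Z k z -> exists2 y, dg_deg Y k y & g y = z }.

Section LongExactSequence.
Variables (X Y Z : dgroup) (f : chmap X Y 0) (g : chmap Y Z 0).
Hypothesis fg : chain_short_exact f g.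
Variables (k l : int) (kl : k = l + 1).

Let gf x : g (f x) = 0. Proof. by apply/(cse_exact fg); exists x. Qed.

Let lk : k - 1 = l. Proof. by rewrite kl addrK. Qed.

Lemma cycle_preimage y : dg_deg Y k y -> cyc Z k (g y) ->
  exists2 x, cyc X l x & f x = dg_d y.
Proof.
move=> yk [_ /chmap_d_eq0 gdy].
have [x fx] := (cse_exact fg (dg_d y)).1 gdy.
exists x => //; split.
  by apply: (cse_deg fg); rewrite fx -lk; exact: dg_d_deg.
apply: (cse_inj fg); rewrite raddf0; apply/chmap_d_eq0.
by rewrite fx dg_dd.
Qed.

Lemma boundary_preimage y : dg_deg Y k y -> bnd Z k (g y) ->
  exists2 u, dg_deg X k u & bnd Y k (y - f u).
Proof.
move=> yk [w wk dw]; have [v vk gv] := cse_surj fg wk.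
have [v' vv' dv'] := chmap_d g v.
have [|u fu] := (cse_exact fg (y - dg_d v')).1.
  by rewrite raddfB /= -dv' gv dw subrr.
exists u.
  apply: (cse_deg fg); rewrite fu; apply: sgB => //.
  by rewrite -(addrK 1 k); apply/dg_d_deg/vv'.
by exists v'; [exact: vv'|rewrite fu opprB addrC subrK].
Qed.

(** The connecting map does not depend on choices: if [g y] bounds, then [y] is
    [f u] up to a boundary, so [f x = dy = d (f u)] and [x] bounds by the
    injectivity of [f].  Applied to differences it also gives additivity. *)
Lemma connecting_welldef x y : cyc X l x -> dg_deg Y k y -> cyc Z k (g y) ->
  f x = dg_d y -> hcls k (g y) = 0 -> hcls l x = 0.
Proof.
move=> Zx yk Zgy fx /(hcls_eq0P Zgy)/(boundary_preimage yk)[u uk [v _ dv]].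
apply/hcls_eq0P => //; have [u' uu' du'] := chmap_d f u.
exists u'; first by rewrite -kl; exact: uu'.
apply: (cse_inj fg); rewrite -du' fx; apply/eqP; rewrite eq_sym -subr_eq0.
by rewrite -raddfB /= -dv dg_dd.
Qed.

Lemma long_exact_sequence :
  exists del : {additive homology Z k -> homology X l},
  is_connecting f g del /\
  [/\ exact_at (hmap0 f k) (hmap0 g k), exact_at (hmap0 g k) del
    & exact_at del (hmap0 f l)].
Proof.
(* choose, for each class c, a lift y of a cycle and the x with f x = dy *)
have liftP (c : homology Z k) : exists xy : X * Y,
    [/\ cyc X l xy.1, dg_deg Y k xy.2, cyc Z k (g xy.2), f xy.1 = dg_d xy.2
      & hcls k (g xy.2) = c].
  have [z Zz <-] := hclsP c; have [y yk gy] := cse_surj fg Zz.1.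
  by rewrite -gy in Zz *; have [x Zx fx] := cycle_preimage yk Zz; exists (x, y).
have [s sP] := choice liftP.
pose del0 c := hcls l (s c).1.
have del0E x y : cyc X l x -> dg_deg Y k y -> cyc Z k (g y) -> f x = dg_d y ->
    del0 (hcls k (g y)) = hcls l x.
  move=> Zx yk Zgy fx; have [Zx' yk' Zgy' fx' gyE] := sP (hcls k (g y)).
  apply/eqP; rewrite -subr_eq0 -hclsB //; apply/eqP.
  have gB : g ((s (hcls k (g y))).2 - y) = g (s (hcls k (g y))).2 - g y.
    exact: raddfB.
  apply: (@connecting_welldef _ ((s (hcls k (g y))).2 - y)).
  - exact: sgB.
  - exact: sgB.
  - by rewrite gB; exact: sgB.
  - by rewrite !raddfB /= fx fx'.
  - by rewrite gB hclsB // gyE subrr.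
have del0B : GRing.zmod_morphism del0.
  move=> c c'; have [Zx yk Zgy fx {1}<-] := sP c.
  have [Zx' yk' Zgy' fx' {1}<-] := sP c'.
  rewrite -hclsB // -raddfB /= (@del0E ((s c).1 - (s c').1)).
  - exact: hclsB.
  - exact: sgB.
  - exact: sgB.
  - by rewrite raddfB; exact: sgB.
  - by rewrite !raddfB /= fx fx'.
have [del delE] := zmod_morphism_additive del0B.
have conn : is_connecting f g del by rewrite /is_connecting delE.
exists del; split=> //; split=> c.
- have [y Zy <-] := hclsP c; rewrite hmap0_cls //; split.
    move=> /(hcls_eq0P (ch_cyc g (esym (addr0 k)) Zy)).
    move=> /(boundary_preimage Zy.1)[u uk yfu].
    have Zu : cyc X k u.
      split=> //; apply: (cse_inj fg); rewrite raddf0; apply/chmap_d_eq0.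
      have [v _ dv] := yfu; have := dg_dd v; rewrite dv raddfB /=.
      by case: Zy => _ ->; rewrite sub0r => /eqP; rewrite oppr_eq0 => /eqP.
    exists (hcls k u); rewrite hmap0_cls //; apply/esym/hcls_eqP => //.
    exact: (ch_cyc f (esym (addr0 k)) Zu).
  move=> [d]; have [u Zu <-] := hclsP d; rewrite hmap0_cls // => E.
  rewrite -hmap0_cls // -E hmap0_cls ?gf ?hcls0 //.
  exact: (ch_cyc f (esym (addr0 k)) Zu).
- have [z Zz <-] := hclsP c; have [y yk gy] := cse_surj fg Zz.1.
  rewrite -gy in Zz *; have [x Zx fx] := cycle_preimage yk Zz.
  rewrite (conn x y) //; split.
    move=> /(hcls_eq0P Zx)[u ul du].
    have [u' uu' du'] := chmap_dV f u.
    have Zyu : cyc Y k (y - f u').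
      split; last by rewrite raddfB /= -du' du fx subrr.
      apply: sgB => //; apply: ch_deg (esym (addr0 k)) _.
      by apply: uu'; rewrite kl.
    by exists (hcls k (y - f u')); rewrite hmap0_cls // raddfB /= gf subr0.
  move=> [d]; have [y' Zy' <-] := hclsP d; rewrite hmap0_cls // => E.
  rewrite -(conn x y) // -E (conn 0 y') ?hcls0 //.
  - exact: sg0.
  - by case: Zy'.
  - exact: (ch_cyc g (esym (addr0 k)) Zy').
  - by rewrite raddf0; case: Zy'.
- have [x Zx <-] := hclsP c; have Zfx := ch_cyc f (esym (addr0 l)) Zx.
  rewrite hmap0_cls //; split.
    move=> /(hcls_eq0P Zfx)[y yl dy].
    have yk : dg_deg Y k y by rewrite kl.
    have Zgy : cyc Z k (g y).
      split; first exact: ch_deg (esym (addr0 k)) yk.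
      by apply/chmap_d_eq0; rewrite dy gf.
    by exists (hcls k (g y)); exact: conn.
  move=> [d]; have [z Zz <-] := hclsP d; have [y yk gy] := cse_surj fg Zz.1.
  rewrite -gy in Zz *; have [x' Zx' fx'] := cycle_preimage yk Zz.
  rewrite (conn x' y) // => E.
  rewrite -hmap0_cls // -E hmap0_cls //; apply/hcls_eq0P.
    exact: (ch_cyc f (esym (addr0 l)) Zx').
  by exists y; rewrite -?kl.
Qed.
End LongExactSequence.

(** * Tensoring with a projective resolution *)

Lemma projective_tens_short_exact (G : zmodType) (Q M N L : gmodule G)
  (u : ghom M N) (v : ghom N L) : gprojective Q ->
  short_exact u v -> short_exact (tens_map (gid Q) u) (tens_map (gid Q) v).
Proof.
move=> Qproj [uI uv vs]; split; first exact: projective_tens_inj.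
  exact: tens_map_exact.
exact: tens_map_surj.
Qed.

Lemma tens_trivial (G : zmodType) (Q M : gmodule G) :
  (forall m : M, m = 0) -> forall t : tens Q M, t = 0.
Proof.
by move=> M0 t; rewrite -(tens_map_gid t) tens_map0r.
Qed.

Section PointwiseShortExact.
Variables (I : Type) (T T' T'' : I -> zmodType).
Variables (f : forall i, {additive T i -> T' i}).
Variables (g : forall i, {additive T' i -> T'' i}).
Hypothesis fg : forall i, short_exact (f i) (g i).

Lemma dprod_inj (x y : dprod T) :
  (fun i => f i (x i)) = (fun i => f i (y i)) :> dprod T' -> x = y.
Proof.
move=> xy; apply: functional_extensionality_dep => i.
have [fI _ _] := fg i; apply: fI.
by have := congr1 (fun z : dprod T' => z i) xy.
Qed.

Lemma dprod_exact (y : dprod T') : (fun i => g i (y i)) = 0 :> dprod T'' <->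
  exists x : dprod T, (fun i => f i (x i)) = y :> dprod T'.
Proof.
split=> [gy|[x <-]].
  have xP i : exists a, f i a = y i.
    have [_ ex _] := fg i; apply/ex.
    by have := congr1 (fun z : dprod T'' => z i) gy.
  exists (fun i => sval (cid (xP i))).
  by apply: functional_extensionality_dep => i; case: cid.
apply: functional_extensionality_dep => i.
by have [_ ex _] := fg i; apply/ex; exists (x i).
Qed.

Lemma dprod_surj (z : dprod T'') : exists2 y : dprod T',
  (forall i, z i = 0 -> y i = 0) & (fun i => g i (y i)) = z :> dprod T''.
Proof.
have yP i : exists b, (z i = 0 -> b = 0) /\ g i b = z i.
  have [zi0|zi0] := eqVneq (z i) 0; first by exists 0; rewrite raddf0 zi0.
  have [_ _ gs] := fg i; have [b gb] := gs (z i).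
  by exists b; split=> // /eqP; rewrite (negPf zi0).
exists (fun i => sval (cid (yP i))).
  by move=> i; case: cid => b [].
by apply: functional_extensionality_dep => i; case: cid => b [].
Qed.

Lemma dprod_support (x : dprod T) i : f i (x i) = 0 -> x i = 0.
Proof. by have [fI _ _] := fg i => fx0; apply: fI; rewrite fx0 raddf0. Qed.
End PointwiseShortExact.

Section Resolution.
Variables (G : zmodType) (P : proj_resolution G).

Lemma mod_map_short_exact (M N L : gmodule G) (u : ghom M N) (v : ghom N L) :
  short_exact u v -> chain_short_exact (mod_map P u) (mod_map P v).
Proof.
move=> uv.
have Puv i : short_exact (tens_map (gid (P i)) u) (tens_map (gid (P i)) v).
  exact: projective_tens_short_exact (@pr_proj _ P i) uv.
split.
- by move=> x y; exact: (dprod_inj Puv).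
- by move=> y; exact: (dprod_exact Puv).
- by move=> k x ux i ik; apply: (dprod_support Puv); exact: ux.
- move=> k z zk; have [y yz vy] := dprod_surj Puv z.
  by exists y => // i ik; apply: yz; exact: zk.
Qed.

Lemma tot_map_short_exact s (X Y Z : gcomplex G) (u : gcmap X Y)
    (v : gcmap Y Z) :
  (forall j, short_exact (u j) (v j)) ->
  chain_short_exact (tot_map P s u) (tot_map P s v).
Proof.
move=> uv.
have Puv ij : short_exact (tens_map (gid (P ij.1)) (u ij.2))
                          (tens_map (gid (P ij.1)) (v ij.2)).
  exact: projective_tens_short_exact (@pr_proj _ P ij.1) (uv ij.2).
split.
- by move=> x y; exact: (dprod_inj Puv).
- by move=> y; exact: (dprod_exact Puv).
- by move=> k x ux i j ijk; apply: (dprod_support (i := (i, j)) Puv); exact: ux.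
- move=> k z zk; have [y yz vy] := dprod_surj Puv z.
  by exists y => // i j ijk; apply: yz; exact: zk.
Qed.

Section Insert.
Variables (T : nat -> zmodType) (r : nat) (a : T r).

(** [a] in position [r] and zero elsewhere; as [T] varies with the position,
    [a] has to be transported along the equality [r = j]. *)
Definition insert_at (j : nat) : T j :=
  if @eqP _ r j is ReflectT e then eq_rect r (fun j => T j) a j e else 0.

Lemma insert_at_same : insert_at r = a.
Proof.
rewrite /insert_at; case: eqP => [e|//].
by rewrite (eq_axiomK e).
Qed.

Lemma insert_at_neq j : j != r -> insert_at j = 0.
Proof. by rewrite /insert_at eq_sym; case: eqP. Qed.

Lemma insert_at_eq0 j : (j = r -> a = 0) -> insert_at j = 0.
Proof.
have [->|/insert_at_neq //] := eqVneq j r.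
by rewrite insert_at_same; apply.
Qed.
End Insert.

Definition tot_insert s (X : gcomplex G) r (y : mod_cplx P (X r)) : tot P s X :=
  fun ij => insert_at (T := fun j => tens (P ij.1) (X j)) (y ij.1) ij.2.

Lemma tot_insert_deg s (X : gcomplex G) r (k l : int) (y : mod_cplx P (X r)) :
  k = l + r%:Z ->
  dg_deg (mod_cplx P (X r)) l y -> dg_deg (tot P s X) k (tot_insert s y).
Proof.
move=> kl yl i j ijk; apply: insert_at_eq0 => jr; apply: yl.
by apply: contra ijk => /eqP il; rewrite kl -il -jr.
Qed.

Section TwoTerm.
Variables (s r : nat) (X : gcomplex G) (L : gmodule G) (u : ghom (X r) L).
Hypothesis ud : forall x, u (gc_d X r x) = 0.
Hypothesis X0 : forall j, j != r -> j != r.+1 -> forall x : X j, x = 0.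
Hypothesis du : short_exact (gc_d X r) u.

(** The short exact sequence makes [X] a resolution of [L], placed in the
    degrees [r + 1] and [r], and tensoring with [P_i] keeps it exact.  The map
    is onto because it is so column by column.  A cycle [x] of its kernel has
    in column [r] the image of a [y] under [X_(r+1) -> X_r].  Let [b] be [y]
    put into column [r + 1]; then [db - x] is a cycle that vanishes in column
    [r], hence in column [r + 1] too, since [P (x) X_(r+1) -> P (x) X_r] is
    injective. *)
Lemma tot_mod_bijective k l (e : k = l + r%:Z) :
  bijective (hmap (tot_mod P s ud) e).
Proof.
have cse := mod_map_short_exact du.
apply: acyclic_kernel_hmap_bijective => {k l e}.
  move=> k l y kl yl; have [y' y'l uy'] := cse_surj cse yl.
  exists (tot_insert s y'); first exact: tot_insert_deg y'l.
  rewrite -uy'; apply: functional_extensionality_dep => i.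
  by rewrite /= /tot_mod_fun /tot_insert insert_at_same.
move=> k x xk dx ux.
pose z : mod_cplx P (X r) := fun i => x (i, r).
have zk : dg_deg (mod_cplx P (X r)) (k - r%:Z) z.
  by move=> i ik; apply: xk; rewrite PoszD -(inj_eq (addIr (- r%:Z))) addrK.
have [y dy] := (cse_exact cse z).1 ux.
have yk : dg_deg (mod_cplx P (X r.+1)) (k - r%:Z) y.
  by apply: (cse_deg cse); rewrite dy.
pose b : tot P s X := tot_insert s y.
have br i : b (i, r) = 0 by apply: insert_at_neq; rewrite neq_ltn ltnSn.
have bk : dg_deg (tot P s X) (k + 1) b.
  by apply: tot_insert_deg yk; rewrite -addn1 PoszD addrA subrK.
pose c := dg_d b - x.
have cr i : c (i, r) = 0.
  rewrite /c dprodB /= /tot_d /= !br raddf0 mul0rz add0r.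
  rewrite /b /tot_insert /= insert_at_same.
  by rewrite -[x (i, r)]/(z i) -dy subrr.
have dc : dg_d c = 0 by rewrite /c dg_dB dg_dd dx subrr.
have c0 : c = 0.
  apply: functional_extensionality_dep => -[i j].
  have [->//|jr] := eqVneq j r.
  have [->|jr1] := eqVneq j r.+1; last exact: (tens_trivial (X0 jr jr1)).
  have [dI _ _] := projective_tens_short_exact (@pr_proj _ P i) du.
  apply: dI; rewrite raddf0.
  have := congr1 (fun z : tot P s X => z (i, r)) dc.
  by rewrite /= /tot_d /= cr raddf0 mul0rz add0r.
exists b => //; split; last by apply/eqP; rewrite -subr_eq0; apply/eqP.
apply: functional_extensionality_dep => i.
by rewrite /= /tot_mod_fun br raddf0.
Qed.
End TwoTerm.
End Resolution.

(** * Truncated complexes *)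

Section GifShortExact.
Variable G : zmodType.
Implicit Types M N L : gmodule G.

Lemma gzero_eq0 (x : gzero G) : x = 0.
Proof. by apply/rowP => -[]. Qed.

Lemma gif_short_exact (a b c : bool) M : b = a || c -> ~~ (a && c) ->
  short_exact (gcomp (gif_in b M) (gif_out a M))
              (gcomp (gif_in c M) (gif_out b M)).
Proof.
case: a b c => [] [] [] //= _ _; split=> //=.
- by move=> y; split=> // _; exists y.
- by move=> y; exists 0; rewrite (gzero_eq0 y).
- by move=> x y _; rewrite (gzero_eq0 x) (gzero_eq0 y).
- by move=> y; split=> [y0|[x xy]]; [exists 0|]; rewrite -?xy -?y0.
- by move=> y; exists y.
- by move=> x y _; rewrite (gzero_eq0 x) (gzero_eq0 y).
- by move=> y; split=> // _; exists 0; rewrite (gzero_eq0 y).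
- by move=> y; exists 0; rewrite (gzero_eq0 y).
Qed.

Lemma gif_true_short_exact (a b : bool) M N L (f : ghom M N) (g : ghom N L) :
  a -> b -> short_exact f g ->
  short_exact (gcomp (gif_in b N) (gcomp f (gif_out a M)))
              (gcomp g (gif_out b N)).
Proof. by case: a => //; case: b. Qed.

Lemma gif_conc_short_exact (a b : bool) M N (f : ghom M N) :
  ~~ a -> b ->
  short_exact (gcomp (gif_in b N) (gcomp f (gif_out a M))) (gif_out b N).
Proof.
case: a b => [] [] // _ _; split=> /=.
- by move=> x y _; rewrite (gzero_eq0 x) (gzero_eq0 y).
- move=> y; split=> [->|[x <-]]; last exact: raddf0.
  by exists 0; exact: raddf0.
- by move=> y; exists y.
Qed.

Lemma gif_false_eq0 (b : bool) M : ~~ b -> forall x : gif b M, x = 0.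
Proof. by case: b => // _; exact: gzero_eq0. Qed.
End GifShortExact.

(** * Exactness of the sequence of facet modules *)

Lemma dirv_subv (R : realType) N (V : {vspace 'rV[R]_N}) (A : set 'rV[R]_N) :
  A `<=` [set` V] -> (dirv A <= V)%VS.
Proof.
(* the second case is the default value of the choice defining dirv *)
move=> AV; rewrite /dirv; case: xgetP => [U _ /(_ V) UV|_]; last exact: sub0v.
by apply/UV => x y Ax Ay; apply: memvB; exact: AV.
Qed.

Section TopeComplex.
Variables (R : realType) (N d n : nat) (X : cut_project R N d n).
Variables (k : nat) (W : 'I_k -> set 'rV[R]_N).

Lemma ctope_facet_dim r F : ctope_facet X W r F -> (r <= n)%N.
Proof.
move=> [P [[[_ _ [h [u [c PE]]]] _ _] [_ [v [a [_ FE]]]] <-]].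
rewrite -(cp_dim_perp X); apply: dimvS; apply: dirv_subv => x.
by rewrite FE PE => -[[]].
Qed.

Lemma gspan0_eq0 (G : zmodType) (M : gmodule G) (A : set M) x :
  A `<=` [set 0] -> gspan A x -> x = 0.
Proof.
move=> A0; apply: (_ : gspan A x -> gker (gid M) x); apply.
by move=> a /A0 ->.
Qed.

(** There are no generators: the facets of the polytopes lie in [E^perp], whose
    dimension is [n]. *)
Lemma Cmod_eq0 r : (n < r)%N -> forall x : Cmod X W r, x = 0.
Proof.
move=> nr x; apply: val_inj.
apply: (@gspan0_eq0 _ _ [set indic_cls X r F | F in ctope_facet X W r]).
  by move=> a [F /ctope_facet_dim rn _]; rewrite ltnNge rn in nr.
by apply/sg_predP; exact: valP.
Qed.

Variable C : tope_complex X W.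

(** Injectivity is exactness at [C_n] together with [C_(n+1) = 0]; the rest is
    exactness in the two lower degrees, as the image of [C_(n-1)] is the
    kernel [C_(n-2)^0].  Three cases arise because this kernel is [Z] for
    [r = 0] and that of the augmentation for [r = 1]. *)
Lemma tope_complex_short_exact r : n = r.+1 ->
  short_exact (tc_bd C r) (Ccores C r).
Proof.
move=> nr; split.
- apply: raddf_inj => x /tc_exact[y <-].
  by rewrite (Cmod_eq0 _ y) ?raddf0 // nr.
- case: r nr => [|[|r]] _; first exact: tc_exact0.
    move=> y; split=> [|[x <-]]; last exact: Ccores_bd.
    by move=> /(congr1 val) /= /tc_exact.
  move=> y; split=> [|[x <-]]; last exact: Ccores_bd.
  by move=> /(congr1 val) /= /tc_exact.
case: r nr => [|[|r]] _; first exact: tc_surj.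
  move=> y; have /sg_predP/tc_exact0[x xy] := valP y.
  by exists x; exact: val_inj.
move=> y; have /sg_predP/tc_exact[x xy] := valP y.
by exists x; exact: val_inj.
Qed.
End TopeComplex.

(** * Columns of the total complex *)

Section Columns.
Variables (G : zmodType) (P : proj_resolution G) (s : nat) (X : gcomplex G).
Implicit Types p q : pred nat.

(** The components of a chain in [P (x) X_j], for a fixed [j], of a truncated
    complex. *)
Definition tot_col p (z : tot P s (trunc X p)) j : mod_cplx P (X j) :=
  fun i => tens_map (gid (P i)) (gif_out (p j) (X j)) (z (i, j)).

Lemma tot_col0 p j : tot_col (0 : tot P s (trunc X p)) j = 0.
Proof. by apply: functional_extensionality_dep => i; exact: raddf0. Qed.

Lemma tot_col_deg p (z : tot P s (trunc X p)) j (k l : int) : k = l + j%:Z ->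
  dg_deg (tot P s (trunc X p)) k z -> dg_deg (mod_cplx P (X j)) l (tot_col z j).
Proof.
move=> -> zk i il; rewrite /tot_col zk ?raddf0 //.
by rewrite PoszD (inj_eq (addIr _)).
Qed.

Lemma tot_col_map p q (pq : forall j, p j.+1 -> q j -> p j = q j.+1)
    (z : tot P s (trunc X p)) j :
  q j -> tot_col (tot_map P s (trunc_map X pq) z) j = tot_col z j.
Proof.
move=> qj; apply: functional_extensionality_dep => i.
rewrite /tot_col [LHS]tens_map_comp; apply: tens_map_eq => // x.
by rewrite /= gif_inK qj.
Qed.

(** The differential of [P] enters the total differential in column [j] with
    the sign [(-1)^(s+j)], which is [-1] under the parity condition. *)
Lemma tot_col_d p (z : tot P s (trunc X p)) j : p j -> odd (s + j) ->
  tot_col (dg_d z) j =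
    mod_map P (gc_d X j) (tot_col z j.+1) - dg_d (tot_col z j).
Proof.
move=> pj sj; apply: functional_extensionality_dep => i.
rewrite dprodB /tot_col [dg_d z]/(tot_d s z) /tot_d raddfD raddfMz.
rewrite -signr_odd sj expr1 mulrN1z addrC; congr (_ - _).
  rewrite /= /mod_map_fun !tens_map_comp; apply: tens_map_eq => // x.
  by rewrite /= gif_inK pj.
by rewrite /= /mc_d !tens_map_comp; exact: tens_map_eq.
Qed.
End Columns.

(** * The squares of the diagram *)

Section Squares.
Variables (R : realType) (N d m k : nat) (X : cut_project R N d m.+1).
Variables (W : 'I_k -> set 'rV[R]_N) (C : tope_complex X W).
Variable P : proj_resolution 'rV[int]_N.
Local Notation n := m.+1.

Lemma incl_proj_short_exact j : short_exact (incl_AT C j) (proj_TC C j).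
Proof.
apply: gif_short_exact; first by rewrite /= leq_eqVlt orbC.
by rewrite /= andbC; case: eqP => // ->; rewrite ltnn.
Qed.

Lemma ident_conc_bijective r (i l : int) (e : i = l + r%:Z) :
  bijective (hmap (ident_conc C P r) e).
Proof.
apply: tot_mod_bijective => [j jr _|]; first exact: gif_false_eq0.
apply: gif_conc_short_exact; last by rewrite /= eqxx.
by rewrite /= neq_ltn ltnSn orbT.
Qed.

Lemma ident_D_bijective (i l : int) (e : i = l + m%:Z) :
  bijective (hmap (ident_D C P) e).
Proof.
apply: tot_mod_bijective => [j jm jm1|].
  apply: gif_false_eq0; apply: contra jm1 => /andP[mj jn].
  by rewrite eqn_leq jn ltn_neqAle eq_sym jm.
apply: gif_true_short_exact; rewrite /= ?leqnn ?leqnSn //.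
exact: tope_complex_short_exact.
Qed.

Lemma ident_concE r (z : tot P n (Cconc C r)) :
  ident_conc C P r z = tot_col z r.
Proof. by []. Qed.

Lemma ident_DE (z : tot P n (Dcplx C)) :
  ident_D C P z = mod_map P (Ccores C m) (tot_col z m).
Proof.
apply: functional_extensionality_dep => i.
by rewrite [RHS]tens_map_comp; exact: tens_map_eq.
Qed.

Section Classes.
Variable i : int.

Lemma vert_A_cls (x : tot P n (Acplx C)) : cyc _ (i + n%:Z) x ->
  cyc _ (i + 1) (tot_col x m) /\
  vert_A C P i (hcls (i + n%:Z) x) = hcls (i + 1) (tot_col x m).
Proof.
move=> Zx; have Zp := ch_cyc (tot_map P n (proj_AC C)) (esym (addr0 _)) Zx.
have := ch_cyc (ident_conc C P m) (deg_pred m i) Zp.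
rewrite /vert_A /comp (hmap0_cls _ Zx) (hmap_cls _ _ Zp).
by rewrite ident_concE tot_col_map //=.
Qed.

Lemma vert_A1_cls (x : tot P n (Acplx C)) : cyc _ (i + n%:Z - 1) x ->
  cyc _ i (tot_col x m) /\
  vert_A1 C P i (hcls (i + n%:Z - 1) x) = hcls i (tot_col x m).
Proof.
move=> Zx; have Zp := ch_cyc (tot_map P n (proj_AC C)) (esym (addr0 _)) Zx.
have := ch_cyc (ident_conc C P m) (deg_pred1 m i) Zp.
rewrite /vert_A1 /comp (hmap0_cls _ Zx) (hmap_cls _ _ Zp).
by rewrite ident_concE tot_col_map //=.
Qed.

Lemma vert_T_cls (y : tot P n (Tcplx C)) : cyc _ (i + n%:Z) y ->
  cyc _ (i + 1) (mod_map P (Ccores C m) (tot_col y m)) /\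
  vert_T C P i (hcls (i + n%:Z) y) =
    hcls (i + 1) (mod_map P (Ccores C m) (tot_col y m)).
Proof.
move=> Zy; have Zp := ch_cyc (tot_map P n (proj_TD C)) (esym (addr0 _)) Zy.
have := ch_cyc (ident_D C P) (deg_pred m i) Zp.
rewrite /vert_T /comp (hmap0_cls _ Zy) (hmap_cls _ _ Zp).
by rewrite ident_DE tot_col_map //= leqnn leqnSn.
Qed.

Lemma vert_C_cls (z : tot P n (Cconc C n)) : cyc _ (i + n%:Z) z ->
  cyc _ i (tot_col z n) /\
  vert_C C P i (hcls (i + n%:Z) z) = hcls i (tot_col z n).
Proof.
move=> Zz; split; first exact: (ch_cyc (ident_conc C P n) erefl Zz).
exact: hmap_cls.
Qed.

(** With [s = n] and [j = n - 1] the sign is [(-1)^(2n-1)]; this is why the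
    squares with connecting maps commute without a sign. *)
Lemma tot_col_dE (y : tot P n (Tcplx C)) : tot_col (dg_d y) m =
  mod_map P (tc_bd C m) (tot_col y n) - dg_d (tot_col y m).
Proof. by apply: tot_col_d; rewrite ?addSn /= ?leqnSn // oddD addbb. Qed.

Lemma square_A_T :
  vert_T C P i \o hmap0 (tot_map P n (incl_AT C)) (i + n%:Z) =1
  hmap0 (mod_map P (Ccores C m)) (i + 1) \o vert_A C P i.
Proof.
move=> c; have [x Zx <-] := hclsP c.
have Zj := ch_cyc (tot_map P n (incl_AT C)) (esym (addr0 _)) Zx.
have [Zv vE] := vert_A_cls Zx; have [_ vjE] := vert_T_cls Zj.
rewrite /comp (hmap0_cls _ Zx) vjE vE (hmap0_cls _ Zv).
by rewrite tot_col_map //= leqnSn.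
Qed.

(** Column [n-1] of a cycle [y] lifts a representative of [vert_T y],
    and its differential is the image of column [n] as column [n-1] of [dy]
    vanishes. *)
Lemma square_T_C (del : homology (mod_cplx P (Cker C m)) (i + 1) ->
    homology (mod_cplx P (Cmod X W n)) i) :
  is_connecting (mod_map P (tc_bd C m)) (mod_map P (Ccores C m)) del ->
  vert_C C P i \o hmap0 (tot_map P n (proj_TC C)) (i + n%:Z) =1
  del \o vert_T C P i.
Proof.
move=> conn c; have [y Zy <-] := hclsP c.
have Zm := ch_cyc (tot_map P n (proj_TC C)) (esym (addr0 _)) Zy.
have [Zv vE] := vert_T_cls Zy; have [Zc cE] := vert_C_cls Zm.
rewrite /comp (hmap0_cls _ Zy) vE cE.
rewrite tot_col_map ?[pred1 _ _]eqxx // in Zc *.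
apply/esym; apply: conn => //.
  exact: tot_col_deg (deg_pred m i) Zy.1.
by have := tot_col_dE y; rewrite Zy.2 tot_col0 => /esym/subr0_eq.
Qed.

(** For a lift [y] of [z] and [x] in [A] with [x = dy], column [n-1] of [x] is
    the image of column [n] of [y] up to the boundary of column [n-1]
    of [y]. *)
Lemma square_C_A (del : homology (tot P n (Cconc C n)) (i + n%:Z) ->
    homology (tot P n (Acplx C)) (i + n%:Z - 1)) :
  is_connecting (tot_map P n (incl_AT C)) (tot_map P n (proj_TC C)) del ->
  vert_A1 C P i \o del =1 hmap0 (mod_map P (tc_bd C m)) i \o vert_C C P i.
Proof.
move=> conn c; have [z Zz <-] := hclsP c.
have cse := tot_map_short_exact P n incl_proj_short_exact.
have [y yk yz] := cse_surj cse Zz.1; rewrite -yz in Zz *.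
have [x Zx xy] := cycle_preimage cse (esym (subrK 1 (i + n%:Z))) yk Zz.
have [Zv vE] := vert_A1_cls Zx; have [Zc cE] := vert_C_cls Zz.
rewrite /comp (conn x y) // vE cE (hmap0_cls _ Zc).
have Zb := ch_cyc (mod_map P (tc_bd C m)) (esym (addr0 _)) Zc.
apply/hcls_eqP => //; exists (- tot_col y m).
  exact/sgN/(tot_col_deg (deg_pred m i) yk).
have xE : tot_col x m = tot_col (dg_d y) m.
  by rewrite -xy tot_col_map //= leqnSn.
rewrite tot_col_map ?[pred1 _ _]eqxx // xE tot_col_dE.
by rewrite raddfN addrAC subrr add0r.
Qed.
End Classes.
End Squares.

Theorem proposition3p15 (R : realType) (N d m : nat)
    (X : cut_project R N d m.+1) (hX : almost_canonical X)
    (r : nat) (W : 'I_r -> set 'rV[R]_N) (hW : singular_family X W)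
    (C : tope_complex X W) (P : proj_resolution 'rV[int]_N) :
  let n := m.+1 in
  let HT Y := homology (tot P n Y) in
  let HM M := homology (mod_cplx P M) in
  let j_ := hmap0 (tot_map P n (incl_AT C)) in
  let m_ := hmap0 (tot_map P n (proj_TC C)) in
  let b1 := hmap0 (mod_map P (tc_bd C n.-1)) in
  let b2 := hmap0 (mod_map P (Ccores C n.-1)) in
  [/\ forall i, short_exact (incl_AT C i) (proj_TC C i),
      short_exact (tc_bd C n.-1) (Ccores C n.-1),
      forall (k l : int) (e : k = l + n.-1%:Z), bijective (hmap (ident_conc C P n.-1) e),
      forall (k l : int) (e : k = l + n.-1%:Z), bijective (hmap (ident_D C P) e) &
  exists (dtop : forall k : int,
            {additive HT (Cconc C n) (k + n%:Z)%R -> HT (Acplx C) (k + n%:Z - 1)%R})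
         (dbot : forall k : int,
            {additive HM (Cker C n.-1) (k + 1)%R -> HM (Cmod X W n) k}),
    [/\ forall k : int, is_connecting (tot_map P n (incl_AT C))
          (tot_map P n (proj_TC C)) (dtop k),
        forall k : int, is_connecting (mod_map P (tc_bd C n.-1))
          (mod_map P (Ccores C n.-1)) (dbot k),
        forall k : int,
          [/\ exact_at (j_ (k + n%:Z)) (m_ (k + n%:Z)),
              exact_at (m_ (k + n%:Z)) (dtop k) &
              exact_at (dtop k) (j_ (k + n%:Z - 1))],
        forall k : int,
          [/\ exact_at (b2 (k + 1)) (dbot k),
              exact_at (dbot k) (b1 k) &
              exact_at (b1 k) (b2 k)] &
        forall k : int,
          [/\ bijective (vert_C C P k),
              vert_T C P k \o j_ (k + n%:Z) =1 b2 (k + 1) \o vert_A C P k,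
              vert_C C P k \o m_ (k + n%:Z) =1 dbot k \o vert_T C P k &
              vert_A1 C P k \o dtop k =1 b1 k \o vert_C C P k]]].
Proof.
move=> n HT HM j_ m_ b1 b2.
have ATC := tot_map_short_exact P n (incl_proj_short_exact C).
have CCC := mod_map_short_exact P (tope_complex_short_exact C (erefl n)).
have topP i := long_exact_sequence ATC (esym (subrK 1 (i + n%:Z))).
have botP (i : int) := long_exact_sequence CCC (erefl (i + 1)).
pose dtop i := sval (cid (topP i)); pose dbot i := sval (cid (botP i)).
have dtopP i := svalP (cid (topP i)); have dbotP i := svalP (cid (botP i)).
split; [exact: incl_proj_short_exact | exact: tope_complex_short_exact
  | exact: ident_conc_bijective | exact: ident_D_bijective |].
exists dtop, dbot; split=> i.
- exact: (dtopP i).1.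
- exact: (dbotP i).1.
- exact: (dtopP i).2.
- have [_ [_ ex1 ex2]] := dbotP i; split=> //.
  (* exactness at H_i(C_(n-1)) belongs to the sequence whose connecting map
     starts in degree i *)
  have [del [_ [ex3 _ _]]] := long_exact_sequence CCC (esym (subrK 1 i)).
  exact: ex3.
split.
- exact: ident_conc_bijective.
- exact: square_A_T.
- exact: square_T_C (dbotP i).1.
- exact: square_C_A (dtopP i).1.
Qed.
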